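(* Let $n\ge 1$, let $Z$ be an $n$-dimensional standard Gaussian random vector, and let $f:\mathbb R^n\to\mathbb R$ be a convex function with $f\in L_2(\gamma_n)$. Then, for all $t>1$, $$\mathbb P \left( f(Z)-\mathbb Ef(Z) < -t \sqrt{ {\rm Var} f(Z)} \right) \leq \frac{1}{2} \exp \left(- \frac{\pi}{1024} (t-1)^2 \right) < e^{-t^2 /1000}.$$
   Context: $\gamma_n$ denotes the standard Gaussian measure on $\mathbb R^n$, i.e. the law of $Z\sim N(\mathbf 0,I_n)$. *)

(* Defs.v *)
From HB Require Import structures.
From mathcomp Require Import all_boot all_order all_algebra.
From mathcomp Require Import all_classical all_reals all_analysis.

Set Implicit Arguments.
Unset Strict Implicit.
Unset Printing Implicit Defensive.

Import Order.TTheory GRing.Theory Num.Theory.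
Import numFieldNormedType.Exports.

Local Open Scope classical_set_scope.
Local Open Scope ring_scope.

(* R^n with its Borel sigma-algebra. The carrier is convertible to 'rV[R]_n,
   which by itself carries no measurable structure. *)
Notation borel_rV R n := (g_sigma_algebraType (@open 'rV[R]_n)).

(* The X i are plain functions: in [std_gaussian_vector] below they are the
   coordinates of a Borel vector, whence measurable. *)
Definition mutually_independent d (T : measurableType d) (R : realType)
    (P : probability T R) (I : finType) (X : I -> T -> R) : Prop :=
  forall (J : {set I}) (A : I -> set R),
    (forall i, i \in J -> measurable (A i)) ->
    P (\bigcap_(i in [set` J]) (X i @^-1` A i)) =
    (\prod_(i in J) fine (P (X i @^-1` A i)))%:E.

(* Z ~ N(0, I_n): the coordinates are independent N(0, 1) variables. *)
Definition std_gaussian_vector d (T : measurableType d) (R : realType)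
    (P : probability T R) (n : nat) (Z : {RV P >-> borel_rV R n}) : Prop :=
  let coord (i : 'I_n) (w : T) : R := (Z w : 'rV[R]_n) ord0 i in
  mutually_independent P coord /\
  forall (i : 'I_n) (A : set R), measurable A ->
    pushforward P (coord i) A = normal_prob 0 1 A.

(* Main.v *)
Require Import Defs.
From mathcomp Require Import all_boot all_order all_algebra.
From mathcomp Require Import all_classical all_reals all_analysis.
From mathcomp Require Import measurable_realfun.
From mathcomp Require Import ring lra.

(** The theorem follows from an upper bound on the Laplace transform: a convex
    function f of a Gaussian vector Z satisfies, for every s >= 0,
<<
      E exp (- s (f(Z) - E f(Z))) <= exp (s ^ 2 Var f(Z))
>>
    ([convex_laplace]). Chernoff's inequality then bounds the lower tail by
    exp (- t ^ 2 / 4), which is enough for t >= 2; for 1 < t <= 2 the Cantelli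
    bound 1 / (1 + t ^ 2) is already below the required value.

    Put Lambda(s) = ln E exp (- s (f(Z) - E f(Z))). The Laplace bound comes
    from the inequality lam ^ 2 Lambda(s) <= Lambda(lam s) for 0 <= lam <= 1
    ([laplace_scaling]): in the limit where lam tends to 0, a second-order
    expansion of the exponential bounds Lambda(lam s) / lam ^ 2 by
    s ^ 2 Var f(Z) ([lip_convex_laplace]).

    The scaling inequality is an instance of a functional inequality for
    Lipschitz functions a, b, h ([interp_gaussian_vector]): if
<<
      b(x) + lam ^ 2 h(y) <= a((1 - lam) x + lam y)   for all x, y,
>>
    then E b(Z) + lam ^ 2 ln E exp h(Z) <= ln E exp a(Z). Convexity of f is
    what makes a = - lam s f, b = - lam (1 - lam) s f, h = - s f admissible.

    In terms of a Brownian motion B, the reason is the variational formula: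
    ln E exp h(B_1) is the supremum over drifts u of
    E [h(B_1 + U) - 1/2 int |u|^2], where U = int u. Using the drift lam u
    for the function a moves the end point to
    B_1 + lam U = (1 - lam) B_1 + lam (B_1 + U), and costs lam ^ 2 times as
    much as u, so the bound for a dominates E b + lam ^ 2 times the bound for
    h. Here time is discretised and the drift is constant on each step, so
    that only one-dimensional Gaussian integrals occur. On a step, the
    Cameron-Martin formula and Jensen's inequality give the inequality up to
    the loss due to the suboptimal drift ([glog_step]). The loss is of the
    order of the variance of the step for any Lipschitz function
    ([glog_err_lip]) and of the order of its square once the function has been
    smoothed by an earlier step ([glog_second_order], [glog_err_smooth]). One
    step of variance eps followed by N steps of variance (1 - eps) / N hence
    gives the one-dimensional inequality as N tends to infinity and then eps
    to 0 ([interp_gauss]). The hypothesis survives integration in one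
    coordinate, so the inequality in dimension n follows coordinate by
    coordinate.

    All this is done for Lipschitz functions, for which every integral
    converges. A general convex function is the increasing limit of its
    envelopes inf_y (f(y) + N |x - y|), which for large N are Lipschitz and
    convex, and which at each point are eventually equal to f. *)

Set Implicit Arguments.
Unset Strict Implicit.
Unset Printing Implicit Defensive.

Import Order.TTheory GRing.Theory Num.Theory.
Import numFieldNormedType.Exports.

Local Open Scope classical_set_scope.
Local Open Scope ring_scope.

(** * Integration against the normal law *)
Section normal_integral.
Context {R : realType}.
Implicit Types (m s x : R) (f : R -> \bar R) (g : R -> R).
Local Notation leb := (@lebesgue_measure R).
Local Notation gam := (@normal_prob R 0 1).

Lemma ge0_integral_normal_prob m s f : measurable_fun [set: R] f ->
  (forall x, (0 <= f x)%E) ->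
  (\int[normal_prob m s]_x f x = \int[leb]_x (f x * (normal_pdf m s x)%:E))%E.
Proof.
move=> mf f0.
have dom := @normal_prob_dominates R m s.
rewrite -(Radon_Nikodym_SigmaFinite.change_of_variables dom)//.
apply: ae_eq_integral => //.
- apply: emeasurable_funM => //.
  exact: measurable_int (Radon_Nikodym_SigmaFinite.f_integrable dom).
- apply: emeasurable_funM => //.
  by apply/measurable_EFinP; exact: measurable_normal_pdf.
- apply: ae_eqe_mul2l; apply: integral_ae_eq => //.
  + exact: Radon_Nikodym_SigmaFinite.f_integrable.
  + by apply/measurable_EFinP; exact: measurable_normal_pdf.
  + by move=> E _ mE; rewrite -Radon_Nikodym_SigmaFinite.f_integral.
Qed.

Lemma normal_pdf_affine m s x : 0 < s ->
  normal_pdf m s (m + s * x) * s = normal_pdf 0 1 x.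
Proof.
move=> s0; rewrite !normal_pdfE ?oner_eq0 ?gt_eqF// /normal_peak /normal_fun.
rewrite -mulrnAr sqrtrM ?sqr_ge0// sqrtr_sqr gtr0_norm//.
rewrite expr1n mul1r subr0 [X in expR X](_ : _ = - x ^+ 2 / (1 *+ 2)); last by field; rewrite gt_eqF.
rewrite invfM mulrAC -[X in X * _]mulrA [_^-1 * s]mulrC mulrA mulVf ?gt_eqF//.
by rewrite mul1r.
Qed.

Lemma integral_gauss_density g : measurable_fun setT g ->
  (forall x, 0 <= g x) ->
  (\int[gam]_t (g t)%:E = \int[leb]_t (g t * normal_pdf 0 1 t)%:E)%E.
Proof.
move=> mg g0; rewrite ge0_integral_normal_prob; first by [].
- exact/measurable_EFinP.
- by move=> x; rewrite lee_fin.
Qed.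

Lemma integral_normal_affine m s g : 0 < s -> continuous g ->
  (forall x, 0 <= g x) ->
  (\int[gam]_t (g (m + s * t))%:E =
   \int[leb]_u (g u * normal_pdf m s u)%:E)%E.
Proof.
move=> s0 cg g0.
have mg : measurable_fun setT g by exact: continuous_measurable_fun.
have dF : forall x, is_derive x 1 (fun t : R => m + s * t) s.
  move=> x; apply: is_derive_eq.
  by rewrite /GRing.scale/=; ring.
have F' : (fun t : R => m + s * t)^`()%classic = cst s.
  by apply/funext => x; rewrite derive1E; case: (dF x).
rewrite integral_gauss_density; last 2 first.
- apply: measurableT_comp => //.
  by apply: measurable_funD => //; exact: measurable_funM.
- by [].
rewrite [RHS](@increasing_ge0_integration_by_substitutionT _ (fun t => m + s * t))//.
- apply: eq_integral => x _.
  by rewrite F' !fctE/= -(normal_pdf_affine m x s0) mulrA.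
- by move=> x y xy; rewrite ltrD2l ltr_pM2l.
- by rewrite F' => x; exact: cvg_cst.
- by rewrite F'; exact: is_cvg_cst.
- by rewrite F'; exact: is_cvg_cst.
- under eq_fun do rewrite addrC.
  apply: (@cvg_comp _ _ _ (fun x => s * x) (fun x => x + m)); last exact: cvg_addrr_Ny.
  apply: gt0_cvgMrNy => //.
- under eq_fun do rewrite addrC.
  apply: (@cvg_comp _ _ _ (fun x => s * x) (fun x => x + m)); last exact: cvg_addrr.
  apply: gt0_cvgMry => //.
- move=> x; apply: cvgM; first exact: cg.
  by apply: continuous_normal_pdf; rewrite gt_eqF.
- by move=> x; rewrite mulr_ge0// normal_pdf_ge0.
Qed.

Lemma normal_pdf_shift r x :
  normal_pdf r 1 x = expR (r * x - r ^+ 2 / 2) * normal_pdf 0 1 x.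
Proof.
rewrite !normal_pdfE ?oner_eq0// mulrCA; congr (_ * _).
by rewrite /normal_fun -expRD; congr expR; rewrite subr0; field.
Qed.

(** Completing the square: for independent G and G', the joint density of G and
    U = x + a G + b G' is also the density of U times a conditional normal
    density of G given U. *)
Lemma normal_pdf_convolution x a b c t u : 0 < a -> 0 < b -> 0 < c ->
  c ^+ 2 = a ^+ 2 + b ^+ 2 ->
  normal_pdf (x + a * t) b u * normal_pdf 0 1 t =
  normal_pdf x c u * normal_pdf (a * (u - x) / c ^+ 2) (b / c) t.
Proof.
move=> a0 b0 c0 c2.
have bc0 : b / c != 0 by rewrite mulf_neq0 ?invr_eq0 ?gt_eqF.
rewrite !normal_pdfE ?oner_eq0 ?gt_eqF// ?divr_gt0// [LHS]mulrACA [RHS]mulrACA.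
congr (_ * _).
  rewrite /normal_peak -!mulrnAr ![Num.sqrt (_ ^+ 2 * _)]sqrtrM ?sqr_ge0// !sqrtr_sqr.
  rewrite !ger0_norm ?divr_ge0// ?ltW//.
  have s0 : Num.sqrt (pi *+ 2 : R) != 0.
    by rewrite gt_eqF// sqrtr_gt0 mulrn_wgt0// pi_gt0.
  by field; rewrite s0 !gt_eqF.
rewrite /normal_fun -!expRD; congr expR.
have b2 : b ^+ 2 = c ^+ 2 - a ^+ 2 by rewrite c2; ring.
have h : c ^+ 2 - a ^+ 2 != 0 by rewrite -b2 expf_neq0// gt_eqF.
rewrite expr_div_n b2; field.
by rewrite h gt_eqF.
Qed.

(** The Cameron-Martin formula in dimension 1. *)
Lemma integral_normal_shift r g : continuous g -> (forall x, 0 <= g x) ->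
  (\int[gam]_t (g (r + t))%:E =
   \int[gam]_t (g t * expR (r * t - r ^+ 2 / 2))%:E)%E.
Proof.
move=> cg g0.
have mg : measurable_fun setT g by exact: continuous_measurable_fun.
under eq_integral do rewrite -[X in r + X]mul1r.
rewrite (integral_normal_affine r ltr01 cg g0) integral_gauss_density; last 2 first.
- apply: measurable_funM => //; apply: measurableT_comp => //.
  by apply: measurable_funB => //; exact: measurable_funM.
- by move=> x; rewrite mulr_ge0// expR_ge0.
by apply: eq_integral => x _; rewrite (normal_pdf_shift r x) mulrA.
Qed.

(** The sum of independent centred normal variables is normal: Tonelli after
    [normal_pdf_convolution], the conditional density having integral 1. *)
Lemma integral_normal_convolution x a b c g : 0 < a -> 0 < b -> 0 < c ->
  c ^+ 2 = a ^+ 2 + b ^+ 2 -> continuous g -> (forall x, 0 <= g x) ->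
  (\int[gam]_t \int[gam]_u (g (x + a * t + b * u))%:E =
   \int[gam]_t (g (x + c * t))%:E)%E.
Proof.
move=> a0 b0 c0 c2 cg g0.
have mg : measurable_fun setT g by exact: continuous_measurable_fun.
pose f (z : measurableTypeR R * measurableTypeR R) : \bar R :=
  (g z.2 * normal_pdf (x + a * z.1) b z.2)%:E.
have mf : measurable_fun setT f.
  apply/measurable_EFinP; apply: measurable_funM; first exact: measurableT_comp.
  rewrite (_ : (fun _ => _) = fun z : measurableTypeR R * measurableTypeR R =>
      normal_pdf 0 b (z.2 - (x + a * z.1))); last first.
    by apply/funext => z; rewrite !normal_pdfE ?gt_eqF// /normal_fun subr0.
  apply: (measurableT_comp (measurable_normal_pdf _ _)).
  apply: measurable_funB => //; apply: measurable_funD => //.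
  exact: measurable_funM.
have f0 z : (0 <= f z)%E by rewrite lee_fin mulr_ge0// normal_pdf_ge0.
transitivity (\int[gam]_t \int[leb]_u f (t, u))%E.
  by apply: eq_integral => t _; rewrite (integral_normal_affine (x + a * t) b0 cg g0).
rewrite ge0_integral_normal_prob//; last 2 first.
- exact: (@measurable_fun_fubini_tonelli_F _ _ _ _ _ leb).
- by move=> t; exact: integral_ge0.
transitivity (\int[leb]_t \int[leb]_u (f (t, u) * (normal_pdf 0 1 t)%:E))%E.
  apply: eq_integral => t _; rewrite ge0_integralZr//.
  - exact: measurableT_comp.
  - by rewrite lee_fin normal_pdf_ge0.
rewrite (@fubini_tonelli _ _ _ _ _ leb leb
    (fun z => f z * (normal_pdf 0 1 z.1)%:E)%E)//=; last 2 first.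
- apply: emeasurable_funM => //; apply/measurable_EFinP.
  exact: (measurableT_comp (measurable_normal_pdf _ _)).
- by move=> z; rewrite mule_ge0// lee_fin normal_pdf_ge0.
rewrite (integral_normal_affine x c0 cg g0).
apply: eq_integral => u _; rewrite /f/=.
transitivity (\int[leb]_t ((g u * normal_pdf x c u)%:E *
    (normal_pdf (a * (u - x) / c ^+ 2) (b / c) t)%:E))%E.
  apply: eq_integral => t _; rewrite -!EFinM; congr EFin.
  by rewrite -[LHS]mulrA -[RHS]mulrA (normal_pdf_convolution x t u a0 b0 c0 c2).
rewrite ge0_integralZl//; last 3 first.
- by apply/measurable_EFinP; exact: measurable_normal_pdf.
- by move=> t _; rewrite lee_fin normal_pdf_ge0.
- by rewrite lee_fin mulr_ge0// normal_pdf_ge0.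
by rewrite integral_normal_pdf mule1 EFinM.
Qed.

End normal_integral.

(** * Lipschitz and subexponential functions *)
Section subexponential.
Context {R : realType}.
Implicit Types (f g : R -> R) (t C K L : R).
Local Notation gam := (@normal_prob R 0 1).

(** The constant is explicit because the error estimates below must depend on
    it alone, uniformly over the functions produced by the Gaussian steps. *)
Definition lip (V : normedModType R) (L : R) (f : V -> R) :=
  forall x y, `|f x - f y| <= L * `|x - y|.

Lemma lip_continuous (V : normedModType R) L (f : V -> R) :
  lip L f -> continuous f.
Proof.
move=> fL x; apply/(@cvgrPdist_lt _ R^o) => e e0.
have K0 : 0 < `|L| + 1 by rewrite ltr_wpDl.
near=> y; apply: le_lt_trans (fL _ _) _.
apply: (@le_lt_trans _ _ ((`|L| + 1) * `|x - y|)).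
  by apply: ler_wpM2r => //; apply: le_trans (ler_norm L) _; rewrite lerDl.
rewrite -ltr_pdivlMl// mulrC; near: y.
apply: cvgr_dist_lt; last by rewrite divr_gt0.
exact: cvg_id.
Unshelve. all: by end_near. Qed.

Lemma lip_le (V : normedModType R) L L' (f : V -> R) :
  L <= L' -> lip L f -> lip L' f.
Proof. by move=> LL fL x y; apply: le_trans (fL x y) _; apply: ler_wpM2r. Qed.

(** A class of continuous functions that is stable under sums and products,
    contains exponentials of Lipschitz functions, and consists of functions
    integrable for the Gaussian law. *)
Definition subexp f :=
  continuous f /\ exists C K, forall t, `|f t| <= C * expR (K * `|t|).

Lemma integral_gauss_expR K :
  (\int[gam]_t (expR (K * t))%:E = (expR (K ^+ 2 / 2))%:E)%E.
Proof.
have c1 : continuous (cst 1 : R -> R) by move=> x; exact: cvg_cst.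
have := integral_normal_shift K c1 (fun=> ler01).
rewrite [X in X = _ -> _](_ : _ = 1%E); last first.
  transitivity (1 * gam setT)%E; last by rewrite probability_setT mul1e.
  by rewrite -integral_cst.
move=> e1.
transitivity (\int[gam]_t ((expR (K ^+ 2 / 2))%:E *
    (cst 1 t * expR (K * t - K ^+ 2 / 2))%:E))%E.
  apply: eq_integral => t _; rewrite -EFinM; congr EFin.
  by rewrite /cst mul1r -expRD; congr expR; ring.
rewrite ge0_integralZl//; first by rewrite -e1 mule1.
- apply/measurable_EFinP; apply: measurable_funM => //.
  by apply: measurableT_comp => //; apply: measurable_funB => //; exact: measurable_funM.
- by move=> t _; rewrite lee_fin mul1r expR_ge0.
Qed.

Lemma expR_normM K t : expR (K * `|t|) <= expR (K * t) + expR ((- K) * t).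
Proof.
case: (ger0P t) => _; first by rewrite lerDl expR_ge0.
by rewrite mulrN mulNr lerDr expR_ge0.
Qed.

Lemma subexp_integrable f : subexp f -> gam.-integrable setT (EFin \o f).
Proof.
move=> [cf [C [K fCK]]].
have mf : measurable_fun setT f by exact: continuous_measurable_fun.
apply/integrableP; split; first exact/measurable_EFinP.
have mE (k : R) : measurable_fun setT (fun t : R => expR (k * t)).
  by apply: measurableT_comp => //; exact: measurable_funM.
apply: (@le_lt_trans _ _ (\int[gam]_t
    (`|C| * (expR (K * t) + expR ((- K) * t)))%:E)%E).
  apply: ge0_le_integral => //.
  - by apply/measurableT_comp => //; apply/measurable_EFinP.
  - apply/measurable_EFinP; apply: measurable_funM => //.
    by apply: measurable_funD; exact: mE.
  - move=> t _; rewrite /= lee_fin; apply: le_trans (fCK t) _.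
    apply: le_trans (_ : `|C| * expR (K * `|t|) <= _).
      by apply: ler_wpM2r; rewrite ?expR_ge0// ler_norm.
    by apply: ler_wpM2l => //; exact: expR_normM.
under eq_integral do rewrite EFinM EFinD.
have mEE (k : R) : measurable_fun setT (fun t : R => (expR (k * t))%:E).
  by apply/measurable_EFinP; exact: mE.
rewrite ge0_integralZl//.
- rewrite ge0_integralD//; [|exact: mEE..].
  rewrite [X in (_ * (X + _))%E](integral_gauss_expR K).
  by rewrite [X in (_ * (_ + X))%E](integral_gauss_expR (- K)) -EFinD -EFinM ltry.
- by apply: emeasurable_funD; exact: mEE.
- by move=> t _; rewrite -EFinD lee_fin addr_ge0// expR_ge0.
Qed.

Lemma subexp_cst c : subexp (cst c).
Proof.
split; first by move=> x; exact: cvg_cst.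
by exists `|c|, 0 => t; rewrite mul0r expR0 mulr1.
Qed.

Lemma subexp_le f C K K' : K <= K' -> (forall t, `|f t| <= C * expR (K * `|t|)) ->
  forall t, `|f t| <= C * expR (K' * `|t|).
Proof.
move=> KK H t; apply: le_trans (H t) _; apply: ler_wpM2l.
  have := le_trans (normr_ge0 _) (H t).
  by rewrite pmulr_lge0 ?expR_gt0.
by rewrite ler_expR; apply: ler_wpM2r.
Qed.

Lemma subexpD f g : subexp f -> subexp g -> subexp (fun t => f t + g t).
Proof.
move=> [cf [C [K fC]]] [cg [C' [K' gC]]]; split.
  by move=> x; apply: (@cvgD _ R^o); [exact: cf|exact: cg].
exists (C + C'), (Num.max K K') => t; apply: le_trans (ler_normD _ _) _.
rewrite mulrDl; apply: lerD.
- by apply: subexp_le fC t; rewrite le_max lexx.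
- by apply: subexp_le gC t; rewrite le_max lexx orbT.
Qed.

Lemma subexpM f g : subexp f -> subexp g -> subexp (fun t => f t * g t).
Proof.
move=> [cf [C [K fC]]] [cg [C' [K' gC]]]; split.
  by move=> x; apply: cvgM; [exact: cf|exact: cg].
exists (C * C'), (K + K') => t; rewrite normrM mulrDl expRD mulrACA.
by apply: ler_pM.
Qed.

Lemma subexpZ c f : subexp f -> subexp (fun t => c * f t).
Proof. by move=> sf; apply: subexpM => //; exact: subexp_cst. Qed.

Lemma subexpB f g : subexp f -> subexp g -> subexp (fun t => f t - g t).
Proof.
move=> sf sg; rewrite (_ : (fun _ => _) = fun t => f t + (-1) * g t).
  by apply: subexpD => //; exact: subexpZ.
by apply/funext => t; rewrite mulN1r.
Qed.

Lemma subexpX n f : subexp f -> subexp (fun t => f t ^+ n).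
Proof.
move=> sf; elim: n => [|n ih].
  by rewrite (_ : (fun _ => _) = cst 1) //; exact: subexp_cst.
rewrite (_ : (fun _ => _) = fun t => f t * f t ^+ n); first exact: subexpM.
by apply/funext => t; rewrite exprS.
Qed.

Lemma lip_expR_bound L f t : lip L f -> expR (f t) <= expR (f 0) * expR (L * `|t|).
Proof.
move=> fL; rewrite -expRD ler_expR -lerBlDl.
by apply: le_trans (ler_norm _) _; have := fL t 0; rewrite subr0.
Qed.

Lemma subexp_expR L f : lip L f -> subexp (fun t => expR (f t)).
Proof.
move=> fL; split.
  by move=> x; apply: continuous_comp; [exact: lip_continuous fL x|exact: continuous_expR].
exists (expR (f 0)), L => t; rewrite ger0_norm ?expR_ge0//.
exact: lip_expR_bound.
Qed.

Lemma ler_expR_id (x : R) : x <= expR x.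
Proof. by apply: le_trans (expR_ge1Dx x); rewrite lerDr. Qed.

Lemma subexp_lip L f : lip L f -> subexp f.
Proof.
move=> fL; split; first exact: lip_continuous fL.
exists (expR `|f 0|), L => t; rewrite -expRD; apply: le_trans (ler_expR_id _).
rewrite -lerBlDl; apply: le_trans (lerB_dist _ _) _.
by have := fL t 0; rewrite subr0.
Qed.

Lemma lip_normr (V : normedModType R) L (f : V -> R) :
  lip L f -> lip L (fun x => `|f x|).
Proof. by move=> fL x y; apply: le_trans (ler_dist_dist _ _) (fL x y). Qed.

Lemma lip_id : lip 1 (fun t : R => t).
Proof. by move=> x y; rewrite mul1r. Qed.

Lemma lip_norm (V : normedModType R) : lip 1 (fun x : V => `|x|).
Proof. by move=> x y; rewrite mul1r ler_dist_dist. Qed.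

Lemma lipZ (V : normedModType R) c L (f : V -> R) :
  lip L f -> lip (`|c| * L) (fun x => c * f x).
Proof.
move=> fL x y; rewrite -mulrBr normrM -mulrA.
by apply: ler_wpM2l.
Qed.

Lemma lipDc (V : normedModType R) c L (f : V -> R) :
  lip L f -> lip L (fun x => c + f x).
Proof. by move=> fL x y; rewrite opprD addrACA subrr add0r. Qed.

End subexponential.

(** * Jensen and Cameron-Martin for the standard Gaussian law *)
Lemma expR_sub1_le (R : realType) (x : R) : expR x - 1 <= x * expR x.
Proof.
have := ler_wpM2r (expR_ge0 x) (expR_ge1Dx (- x)).
by rewrite -expRD addNr expR0 mulrDl mul1r mulNr; lra.
Qed.

Lemma expR_le_quadratic (R : realType) (x : R) : expR x <= 1 + x + x ^+ 2 * expR `|x|.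
Proof.
have h1 := expR_sub1_le x.
have h2 := expR_ge1Dx x.
have e1 : 1 <= expR `|x| by rewrite -[leLHS]expR0 ler_expR.
case: (lerP 0 x) => x0.
  rewrite ger0_norm//.
  have : x * (expR x - 1) <= x * (x * expR x) by exact: ler_wpM2l.
  by rewrite expr2 mulrBr mulr1 mulrA; lra.
have : 0 <= (- x) * (expR x - 1 - x).
  by apply: mulr_ge0; [rewrite oppr_ge0 ltW|lra].
have : 0 <= x ^+ 2 * (expR `|x| - 1) by rewrite mulr_ge0 ?sqr_ge0// subr_ge0.
by rewrite !mulrBr mulr1 expr2; nra.
Qed.

Section jensen.
Context d (T : measurableType d) (R : realType) (P : probability T R).

Lemma Rintegral_cst1 (c : R) : \int[P]_(_ in setT) c = c.
Proof.
transitivity (c * fine (P setT)); first exact: Rintegral_cst.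
by rewrite probability_setT mulr1.
Qed.

(** Jensen's inequality: integrate the tangent of exp at the mean. *)
Lemma expR_Rintegral_le (f : T -> R) :
  P.-integrable setT (EFin \o f) ->
  P.-integrable setT (EFin \o (expR \o f)) ->
  expR (\int[P]_x f x) <= \int[P]_x expR (f x).
Proof.
move=> fi efi; set m := \int[P]_x f x.
have ic c : P.-integrable setT (EFin \o cst c) by exact: finite_measure_integrable_cst.
have i1 : P.-integrable setT (EFin \o (fun x => f x + (1 - m))).
  exact: (integrableD measurableT fi (ic (1 - m))).
have i2 : P.-integrable setT (EFin \o (fun x => expR m * (f x + (1 - m)))).
  exact: (integrableZl measurableT (expR m) i1).
have -> : expR m = \int[P]_x (expR m * (f x + (1 - m))).
  rewrite RintegralZl// RintegralD//; last exact: ic.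
  by rewrite -/m Rintegral_cst1 addrC subrK mulr1.
apply: le_Rintegral => // x _.
rewrite -[f x in leRHS](subrK m) expRD mulrC; apply: ler_wpM2r; first exact: expR_ge0.
by apply: le_trans (expR_ge1Dx _); lra.
Qed.

End jensen.

Section gauss_expectation.
Context {R : realType}.
Implicit Types (f g : R -> R).
Local Notation gam := (@normal_prob R 0 1).

Lemma gaussE_cst (c : R) : \int[gam]_t c = c.
Proof. exact: (Rintegral_cst1 gam). Qed.

Lemma gaussE_le f g : subexp f -> subexp g -> (forall t, f t <= g t) ->
  \int[gam]_t f t <= \int[gam]_t g t.
Proof. by move=> sf sg fg; apply: le_Rintegral => //; exact: subexp_integrable. Qed.

Lemma gaussED f g : subexp f -> subexp g ->
  \int[gam]_t (f t + g t) = \int[gam]_t f t + \int[gam]_t g t.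
Proof. by move=> sf sg; apply: RintegralD => //; exact: subexp_integrable. Qed.

Lemma gaussEB f g : subexp f -> subexp g ->
  \int[gam]_t (f t - g t) = \int[gam]_t f t - \int[gam]_t g t.
Proof. by move=> sf sg; apply: RintegralB => //; exact: subexp_integrable. Qed.

Lemma gaussEZ c f : subexp f -> \int[gam]_t (c * f t) = c * \int[gam]_t f t.
Proof. by move=> sf; apply: RintegralZl => //; exact: subexp_integrable. Qed.

Lemma gaussE_jensen f L : lip L f ->
  expR (\int[gam]_t f t) <= \int[gam]_t expR (f t).
Proof.
move=> fL; apply: expR_Rintegral_le; apply: subexp_integrable.
  exact: subexp_lip fL.
exact: subexp_expR fL.
Qed.

Lemma gaussE_expR_gt0 f L : lip L f -> 0 < \int[gam]_t expR (f t).
Proof. by move=> fL; apply: lt_le_trans (gaussE_jensen fL); exact: expR_gt0. Qed.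

(** By Jensen, exp (m ^ 2) <= E exp (m G) = exp (m ^ 2 / 2) for the mean m,
    so that m ^ 2 <= 0. *)
Lemma gaussE_id : \int[gam]_t t = 0.
Proof.
set m := \int[gam]_t t.
have h : expR (m * m) <= expR (m ^+ 2 / 2).
  have l : lip `|m| (fun t : R => m * t) by rewrite -[`|m|]mulr1; apply: lipZ; exact: lip_id.
  have := gaussE_jensen l.
  rewrite gaussEZ; last exact: subexp_lip lip_id.
  by rewrite -/m /Rintegral integral_gauss_expR.
move: h; rewrite ler_expR -expr2 => h.
by apply/eqP; rewrite -sqrf_eq0 eq_le sqr_ge0 andbT; lra.
Qed.

Lemma gaussE_shift r f : subexp f -> (forall t, 0 <= f t) ->
  \int[gam]_t f (r + t) = \int[gam]_t (f t * expR (r * t - r ^+ 2 / 2)).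
Proof. by move=> [cf _] f0; rewrite /Rintegral integral_normal_shift. Qed.

Lemma lip_affine (c r : R) : lip `|c| (fun t : R => r + c * t).
Proof. by apply: lipDc; rewrite -[`|c|]mulr1; apply: lipZ; exact: lip_id. Qed.

Lemma lipD (V : normedModType R) L L' (f g : V -> R) :
  lip L f -> lip L' g -> lip (L + L') (fun x => f x + g x).
Proof.
move=> fL gL x y; rewrite opprD addrACA mulrDl.
by apply: le_trans (ler_normD _ _) _; exact: lerD.
Qed.

Lemma lip_shift L f r : lip L f -> lip L (fun t => f (r + t)).
Proof. by move=> fL s t; apply: le_trans (fL _ _) _; rewrite opprD addrACA subrr add0r. Qed.

Lemma gaussE_cameron_martin L f r : lip L f ->
  \int[gam]_t expR (f t) = \int[gam]_t expR (f (r + t) - r * t - r ^+ 2 / 2).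
Proof.
move=> fL.
have l : lip (L + `|- r|) (fun t => f t + (r ^+ 2 / 2 + (- r) * t)).
  by apply: lipD => //; exact: lip_affine.
have := @gaussE_shift r (fun t => expR (f t + (r ^+ 2 / 2 + (- r) * t))) (subexp_expR l) (fun=> expR_ge0 _).
rewrite [X in X = _ -> _](_ : _ = \int[gam]_t expR (f (r + t) - r * t - r ^+ 2 / 2)); last first.
  by apply: eq_Rintegral => t _; congr expR; field.
move=> ->; apply: eq_Rintegral => t _; rewrite -expRD; congr expR; ring.
Qed.

Lemma ln_le_subr1 (x : R) : 0 < x -> ln x <= x - 1.
Proof.
move=> x0; rewrite -ler_expR lnK ?posrE//.
by apply: le_trans (expR_ge1Dx _); lra.
Qed.

(** The gap in Jensen's inequality is of second order in f. *)
Lemma gaussE_log_le f L B : lip L f -> subexp B ->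
  (forall t, f t ^+ 2 * expR `|f t| <= B t) ->
  ln (\int[gam]_t expR (f t)) <= \int[gam]_t f t + \int[gam]_t B t.
Proof.
move=> fL sB fB; apply: le_trans (ln_le_subr1 (gaussE_expR_gt0 fL)) _.
have sf := subexp_lip fL.
have s1 : subexp (fun t => (cst 1 t + f t) + B t).
  by apply: subexpD => //; apply: subexpD => //; exact: subexp_cst.
suff : \int[gam]_t expR (f t) <= \int[gam]_t ((cst 1 t + f t) + B t).
  rewrite gaussED//; last by apply: subexpD => //; exact: subexp_cst.
  by rewrite gaussED//; [rewrite gaussE_cst; lra|exact: subexp_cst].
apply: gaussE_le => //; first exact: subexp_expR fL.
by move=> t; apply: le_trans (expR_le_quadratic _) _; rewrite lerD2l.
Qed.

End gauss_expectation.

(** * One Gaussian step *)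
Section gauss_operators.
Context {R : realType} {V : normedModType R}.
Implicit Types (e x y z : V) (a b f g h : V -> R).
Local Notation gam := (@normal_prob R 0 1).

(** [gmean] is the Gaussian average in the direction e, and [glog] its
    exponential counterpart ln (gmean exp); both preserve Lipschitz constants.
    The variance of the step is carried by the length of e. *)
Definition gmean e f x : R := \int[gam]_t f (x + t *: e).
Definition glog e f x : R := ln (gmean e (fun y => expR (f y)) x).

Lemma lip_line L f x e : lip L f -> lip (L * `|e|) (fun t : R => f (x + t *: e)).
Proof.
move=> fL s t; apply: le_trans (fL _ _) _.
by rewrite opprD addrACA subrr add0r -scalerBl normrZ mulrCA mulrC.
Qed.

Lemma subexp_line L f x e : lip L f -> subexp (fun t : R => f (x + t *: e)).
Proof. by move=> fL; apply: subexp_lip; exact: lip_line fL. Qed.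

Lemma subexp_expR_line L f x e : lip L f ->
  subexp (fun t : R => expR (f (x + t *: e))).
Proof. by move=> fL; apply: subexp_expR; exact: lip_line fL. Qed.

Lemma expR_glog L e f x : lip L f ->
  expR (glog e f x) = gmean e (fun y => expR (f y)) x.
Proof.
by move=> fL; rewrite lnK// posrE; apply: gaussE_expR_gt0; exact: lip_line fL.
Qed.

Lemma gmean_lip L e f : lip L f -> lip L (gmean e f).
Proof.
move=> fL x y; rewrite /gmean -gaussEB; [|exact: subexp_line fL..].
have key t : `|f (x + t *: e) - f (y + t *: e)| <= L * `|x - y|.
  by apply: le_trans (fL _ _) _; rewrite opprD addrACA subrr addr0.
have sB : subexp (fun t : R => f (x + t *: e) - f (y + t *: e)).
  by apply: subexpB; exact: subexp_line fL.
rewrite ler_norml -{1}(gaussE_cst (- (L * `|x - y|))) -{2}(gaussE_cst (L * `|x - y|)).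
by apply/andP; split; apply: gaussE_le => //; try exact: subexp_cst;
  move=> t; have := key t; rewrite ler_norml => /andP[].
Qed.

Lemma glog_lip L e f : lip L f -> lip L (glog e f).
Proof.
move=> fL.
suff H x y : glog e f x <= glog e f y + L * `|x - y|.
  move=> x y; rewrite ler_norml; apply/andP; split.
    by rewrite lerBrDr addrC lerBlDr distrC; exact: H.
  by rewrite lerBlDl; exact: H.
rewrite -ler_expR expRD !(expR_glog _ _ fL) mulrC /gmean.
rewrite -gaussEZ; last exact: subexp_expR_line fL.
apply: gaussE_le.
- exact: subexp_expR_line fL.
- by apply: subexpZ; exact: subexp_expR_line fL.
- move=> t; rewrite -expRD ler_expR -lerBlDr.
  apply: le_trans (ler_norm _) _; apply: le_trans (fL _ _) _.
  by rewrite opprD addrACA subrr addr0.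
Qed.

Lemma gmean0 f x : gmean 0 f x = f x.
Proof.
rewrite /gmean; under eq_Rintegral do rewrite scaler0 addr0.
exact: gaussE_cst.
Qed.

Lemma glog0 f : glog 0 f = f.
Proof. by apply/funext => x; rewrite /glog gmean0 expRK. Qed.

(** One step of the drift argument. Translating the integral of exp a by lam r
    with the Cameron-Martin formula costs (lam r) ^ 2 / 2, and Jensen's
    inequality leaves the average of a at (1 - lam) (x + t e) +
    lam (y + (r + t) e), to which the hypothesis applies. *)
Lemma glog_step (lam r err : R) L e a b h x y : 0 <= lam ->
  lip L a -> lip L b -> lip L h ->
  (forall x y, b x + lam ^+ 2 * h y - err <= a ((1 - lam) *: x + lam *: y)) ->
  gmean e b x + lam ^+ 2 * (\int[gam]_t h (y + (r + t) *: e) - r ^+ 2 / 2) - err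
    <= glog e a ((1 - lam) *: x + lam *: y).
Proof.
move=> lam0 aL bL hL H; set z := (1 - lam) *: x + lam *: y.
have aL' := lip_line z e aL; set f := (fun t : R => a (z + t *: e)) in aL'.
have hL' := lip_line y e hL; set k := (fun t : R => h (y + t *: e)) in hL'.
pose rho := lam * r.
have fL : lip (L * `|e| + `|- rho|) (fun t => f (rho + t) + (- (rho ^+ 2 / 2) + (- rho) * t)).
  by apply: lipD; [exact: lip_shift|exact: lip_affine].
have sf := subexp_lip (lip_shift rho aL').
have sl : subexp (fun t => - (rho ^+ 2 / 2) + (- rho) * t).
  exact: subexp_lip (@lip_affine _ (- rho) (- (rho ^+ 2 / 2))).
have sk := subexp_lip (lip_shift r hL').
have sb := subexp_line x e bL.
have E1 : \int[gam]_t (- (rho ^+ 2 / 2) + (- rho) * t) = - (rho ^+ 2 / 2).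
  rewrite gaussED; [|exact: subexp_cst|exact: subexpZ (subexp_lip lip_id)].
  by rewrite gaussE_cst gaussEZ ?gaussE_id ?mulr0 ?addr0//; exact: subexp_lip lip_id.
rewrite -ler_expR (expR_glog _ _ aL) /gmean -/f (gaussE_cameron_martin rho aL').
rewrite [leRHS](_ : _ = \int[gam]_t expR (f (rho + t) + (- (rho ^+ 2 / 2) + (- rho) * t))); last first.
  by apply: eq_Rintegral => t _; congr expR; ring.
apply: le_trans (gaussE_jensen fL); rewrite ler_expR gaussED// E1.
rewrite mulrBr [lam ^+ 2 * (r ^+ 2 / 2)](_ : _ = rho ^+ 2 / 2); last first.
  by rewrite /rho exprMn mulrA.
suff : \int[gam]_t b (x + t *: e) + lam ^+ 2 * \int[gam]_t k (r + t) - err <=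
  \int[gam]_t f (rho + t) by rewrite /k; lra.
rewrite -gaussEZ// -gaussED//; last exact: subexpZ.
rewrite -[X in _ - X](gaussE_cst err) -gaussEB; last exact: subexp_cst.
  apply: gaussE_le => //.
    by apply: subexpB; [apply: subexpD => //; exact: subexpZ|exact: subexp_cst].
  move=> t; apply: le_trans (H _ _) _.
  rewrite /f (_ : _ + _ = z + (rho + t) *: e)// /z !scalerDr !scalerA addrACA.
  by rewrite -scalerDl /rho; congr (_ + _ *: _); ring.
by apply: subexpD => //; exact: subexpZ.
Qed.

End gauss_operators.

(** * Loss caused by a constant drift *)
Section gauss_errors.
Context {R : realType} {V : normedModType R}.
Implicit Types (e x y z : V) (a b f g h : V -> R).
Local Notation gam := (@normal_prob R 0 1).

Lemma ln_gaussE_expRD L (f : R -> R) (c : R) : lip L f ->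
  ln (\int[gam]_t expR (c + f t)) = c + ln (\int[gam]_t expR (f t)).
Proof.
move=> fL; under eq_Rintegral do rewrite expRD.
rewrite gaussEZ; last exact: subexp_expR fL.
by rewrite lnM ?posrE ?expR_gt0 ?expRK//; exact: gaussE_expR_gt0 fL.
Qed.

(** For the drift r, the loss is ln E exp q - E q, where q is what remains of h
    after subtracting its value at x and the linear part of slope r; it is of
    second order in q. *)
Lemma glog_err L h e x (r : R) (B : R -> R) : lip L h -> subexp B ->
  (forall t, (h (x + (r + t) *: e) - h x - r * (r + t)) ^+ 2 *
      expR `|h (x + (r + t) *: e) - h x - r * (r + t)| <= B t) ->
  glog e h x <= \int[gam]_t h (x + (r + t) *: e) - r ^+ 2 / 2 + \int[gam]_t B t.
Proof.
move=> hL sB HB.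
have kL := lip_line x e hL; set k := (fun t : R => h (x + t *: e)) in kL.
pose q (t : R) := k (r + t) + (- h x - r ^+ 2 + (- r) * t).
have qL : lip (L * `|e| + `|- r|) q.
  by apply: lipD; [exact: lip_shift|exact: lip_affine].
have qE t : h (x + (r + t) *: e) - h x - r * (r + t) = q t by rewrite /q /k; ring.
rewrite /glog /gmean -/k (gaussE_cameron_martin r kL).
rewrite [X in ln X](_ : _ = \int[gam]_t expR ((h x + r ^+ 2 / 2) + q t)); last first.
  by apply: eq_Rintegral => t _; congr expR; rewrite /q; field.
rewrite (ln_gaussE_expRD _ qL).
have H1 : forall t, q t ^+ 2 * expR `|q t| <= B t by move=> t; rewrite -qE; exact: HB.
have := gaussE_log_le qL sB H1.
have sl : subexp (fun t => - h x - r ^+ 2 + (- r) * t).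
  exact: subexp_lip (@lip_affine _ (- r) (- h x - r ^+ 2)).
rewrite [X in _ <= X + _ -> _]gaussED//; last exact: subexp_lip (lip_shift r kL).
rewrite [X in _ <= _ + X + _ -> _](_ : _ = - h x - r ^+ 2); last first.
  rewrite gaussED; [|exact: subexp_cst|exact: subexpZ (subexp_lip lip_id)].
  by rewrite gaussE_cst gaussEZ ?gaussE_id ?mulr0 ?addr0//; exact: subexp_lip lip_id.
rewrite /k.
set A := ln _; set I := \int[gam]_t h _; set J := \int[gam]_t B t; set hx := h x.
by move: A I J hx => A I J hx; lra.
Qed.

Definition err_lip (L : R) := \int[gam]_t ((L * t) ^+ 2 * expR (L * `|t|)).

Lemma subexp_err_lip (L : R) : subexp (fun t => (L * t) ^+ 2 * expR (L * `|t|)).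
Proof.
apply: subexpM; first by apply: subexpX; apply: subexpZ; exact: subexp_lip lip_id.
by apply: subexp_expR; apply: lipZ; exact: lip_norm.
Qed.

(** Loss for the zero drift: q is of the order of the step, hence the loss is of
    the order of its variance. *)
Lemma glog_err_lip L h e x (s : R) : 0 <= L -> lip L h -> `|e| <= 1 -> 0 <= s <= 1 ->
  glog (s *: e) h x <=
    \int[gam]_t h (x + (0 + t) *: (s *: e)) - 0 ^+ 2 / 2 + s ^+ 2 * err_lip L.
Proof.
move=> L0 hL e1 /andP[s0 s1].
rewrite /err_lip -gaussEZ; last exact: subexp_err_lip.
apply: (glog_err hL); first by apply: subexpZ; exact: subexp_err_lip.
move=> t; rewrite mul0r subr0 add0r.
set q := h _ - h x.
have q1 : `|q| <= s * `|L * t|.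
  apply: le_trans (hL _ _) _; rewrite addrAC subrr add0r (normrZ t) (normrZ s) (normrM L).
  rewrite (ger0_norm L0) (ger0_norm s0).
  rewrite [leRHS](_ : _ = L * (`|t| * (s * 1))); last by ring.
  by do 3 apply: ler_wpM2l => //.
rewrite mulrA -exprMn; apply: ler_pM; rewrite ?sqr_ge0 ?expR_ge0//.
  rewrite -ler_sqrt ?sqr_ge0// !sqrtr_sqr [leRHS]normrM (ger0_norm s0)//.
rewrite ler_expR; apply: le_trans q1 _; rewrite normrM (ger0_norm L0).
by apply: ler_piMl => //; rewrite mulr_ge0.
Qed.

Definition err_smooth (L M : R) :=
  \int[gam]_t ((M * (L + `|t|) ^+ 2) ^+ 2 * expR (2 * L * L + 2 * L * `|t|)).

Lemma subexp_err_smooth (L M : R) :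
  subexp (fun t => (M * (L + `|t|) ^+ 2) ^+ 2 * expR (2 * L * L + 2 * L * `|t|)).
Proof.
apply: subexpM.
  apply: subexpX; apply: subexpZ; apply: subexpX.
  by apply: subexp_lip; apply: lipDc; exact: lip_norm.
by apply: subexp_expR; apply: lipDc; apply: lipZ; exact: lip_norm.
Qed.

(** Loss for the drift given by the slope p of h at x: q is of the order of the
    variance of the step, and the loss of the order of its square. *)
Lemma glog_err_smooth L M h e x (s p : R) : 0 <= L -> 0 <= M ->
  lip L h -> `|e| <= 1 -> 0 <= s <= 1 ->
  (forall u : R, `|h (x + u *: e) - h x - p * u| <= M * u ^+ 2) ->
  exists r : R, glog (s *: e) h x <=
    \int[gam]_t h (x + (r + t) *: (s *: e)) - r ^+ 2 / 2 + s ^+ 4 * err_smooth L M.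
Proof.
move=> L0 M0 hL e1 /andP[s0 s1] Hp.
have hLu (u : R) : `|h (x + u *: e) - h x| <= L * `|u|.
  apply: le_trans (hL _ _) _; rewrite addrAC subrr add0r normrZ.
  by apply: ler_wpM2l => //; exact: ler_piMr.
(* let u tend to 0 in the second-order expansion *)
have pL : `|p| <= L.
  apply/ler_addgt0Pl => eps eps0.
  have M1 : 0 < M + 1 by rewrite ltr_wpDl.
  pose u := eps / (M + 1); have u0 : 0 < u by rewrite divr_gt0.
  have := Hp u; have := hLu u; rewrite (gtr0_norm u0).
  set D := h _ - h x => h1 h2.
  have h3 : `|p * u| <= L * u + M * u ^+ 2.
    have -> : p * u = D - (D - p * u) by ring.
    by apply: le_trans (ler_normB _ _) _; exact: lerD.
  have : `|p| * u <= (L + M * u) * u.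
    have -> : (L + M * u) * u = L * u + M * u ^+ 2 by ring.
    by apply: le_trans h3; rewrite normrM (gtr0_norm u0).
  rewrite ler_pM2r// => /le_trans; apply.
  rewrite addrC lerD2r /u mulrCA; apply: ler_piMr; first exact: ltW.
  by rewrite ler_pdivrMr// mul1r lerDl.
exists (s * p).
rewrite /err_smooth -gaussEZ; last exact: subexp_err_smooth.
apply: (glog_err hL); first by apply: subexpZ; exact: subexp_err_smooth.
move=> t; rewrite scalerA; set u := (s * p + t) * s.
have -> : s * p * (s * p + t) = p * u by rewrite /u; ring.
set q := h _ - h x - p * u.
have u1 : `|u| <= s * (L + `|t|).
  rewrite /u normrM (ger0_norm s0) mulrC; apply: ler_wpM2l => //.
  apply: le_trans (ler_normD _ _) _; rewrite lerD2r normrM (ger0_norm s0).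
  by apply: le_trans pL; exact: ler_piMl.
have Lt0 : 0 <= L + `|t| by rewrite addr_ge0.
have u2 : `|u| <= L + `|t| by apply: le_trans u1 _; exact: ler_piMl.
have q1 : `|q| <= s ^+ 2 * (M * (L + `|t|) ^+ 2).
  apply: le_trans (Hp u) _; rewrite [leRHS]mulrCA; apply: ler_wpM2l => //.
  rewrite -exprMn -[u ^+ 2]real_normK ?num_real//.
  by rewrite ler_sqr ?nnegrE// mulr_ge0.
have q2 : `|q| <= 2 * L * (L + `|t|).
  apply: le_trans (ler_normB _ _) _; rewrite normrM.
  apply: le_trans (_ : L * `|u| + L * `|u| <= _).
    by apply: lerD; [exact: hLu|exact: ler_wpM2r].
  rewrite [leRHS](_ : _ = L * (L + `|t|) + L * (L + `|t|)); last by ring.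
  by apply: lerD; exact: ler_wpM2l.
have -> : s ^+ 4 * ((M * (L + `|t|) ^+ 2) ^+ 2 * expR (2 * L * L + 2 * L * `|t|)) =
    (s ^+ 2 * (M * (L + `|t|) ^+ 2)) ^+ 2 * expR (2 * L * (L + `|t|)).
  rewrite mulrA [in RHS]exprMn -exprM; congr (_ * expR _); ring.
apply: ler_pM; rewrite ?sqr_ge0 ?expR_ge0//; last by rewrite ler_expR.
rewrite -[q ^+ 2]real_normK ?num_real// ler_sqr ?nnegrE//.
exact: le_trans q1.
Qed.

End gauss_errors.

(** * Smoothing by a Gaussian step *)
Section gauss_smoothing.
Context {R : realType} {V : normedModType R}.
Implicit Types (e x y z : V) (a b f g h : V -> R).
Local Notation gam := (@normal_prob R 0 1).

(** Let m be the mean of the probability with density proportional to exp k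
    with respect to the Gaussian law. Its centred log-Laplace transform is
    nonnegative and at most quadratic near 0, with constants that depend on
    the Lipschitz constant of k only: exp k is comparable with
    exp k(0) up to a factor exp (L |t|). *)
Lemma tilted_laplace_bounds (L : R) : 0 <= L -> exists m0 C : R,
  [/\ 0 <= m0, 0 <= C & forall k : R -> R, lip L k -> exists m : R, `|m| <= m0 /\
    forall rho : R, let D := ln (\int[gam]_t expR (k t + rho * t)) -
      ln (\int[gam]_t expR (k t)) in
    rho * m <= D /\ (`|rho| <= 1 -> D <= rho * m + C * rho ^+ 2)].
Proof.
move=> L0.
pose z := \int[gam]_t expR (- L * `|t|).
have lN (c : R) : lip (`|c| * 1) (fun t : R => c * `|t|) by apply: lipZ; exact: lip_norm.
have z0 : 0 < z by exact: gaussE_expR_gt0 (lN (- L)).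
have sE : subexp (fun t : R => expR (L * `|t|)) by exact: subexp_expR (lN L).
have sN : subexp (fun t : R => `|t|) by exact: subexp_lip (@lip_norm _ R^o).
have sI : subexp (fun t : R => t) by exact: subexp_lip lip_id.
have sM0 : subexp (fun t : R => `|t| * expR (L * `|t|)) by exact: subexpM.
pose m0 := (\int[gam]_t (`|t| * expR (L * `|t|))) / z.
have m00 : 0 <= m0.
  apply: divr_ge0; last exact: ltW.
  by apply: Rintegral_ge0 => t _; rewrite mulr_ge0// expR_ge0.
pose B (t : R) := expR (L * `|t|) * ((m0 + `|t|) ^+ 2 * expR (m0 + `|t|)).
have sB : subexp B.
  apply: subexpM => //; apply: subexpM.
    by apply: subexpX; apply: subexp_lip; apply: lipDc; exact: (@lip_norm _ R^o).
  by apply: subexp_expR; apply: lipDc; exact: (@lip_norm _ R^o).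
pose C := (\int[gam]_t B t) / z.
have C0 : 0 <= C.
  apply: divr_ge0; last exact: ltW.
  apply: Rintegral_ge0 => t _; apply: mulr_ge0; first exact: expR_ge0.
  by apply: mulr_ge0; [exact: sqr_ge0|exact: expR_ge0].
exists m0, C; split => // k kL.
have sk : subexp (fun t => expR (k t)) by exact: subexp_expR kL.
have ku t : expR (k t) <= expR (k 0) * expR (L * `|t|) by exact: lip_expR_bound.
have kl t : expR (k 0) * expR (- L * `|t|) <= expR (k t).
  rewrite -expRD ler_expR mulNr lerBlDr -lerBlDl.
  by apply: le_trans (ler_norm _) _; have := kL 0 t; rewrite sub0r normrN.
pose Z := \int[gam]_t expR (k t).
have Z0 : 0 < Z by exact: gaussE_expR_gt0 kL.
have Zz : expR (k 0) * z <= Z.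
  by rewrite -gaussEZ; [apply: gaussE_le => //; apply: subexpZ|]; exact: subexp_expR (lN (- L)).
(* k only enters the bound through its normalising constant Z *)
have dom (F G : R -> R) : subexp F -> subexp (fun t => expR (L * `|t|) * G t) ->
    (forall t, F t <= G t) -> (forall t, 0 <= G t) ->
    \int[gam]_t (expR (k t) * F t) <=
      (\int[gam]_t (expR (L * `|t|) * G t)) / z * Z.
  move=> sF sG FG G0.
  have I0 : 0 <= \int[gam]_t (expR (L * `|t|) * G t).
    by apply: Rintegral_ge0 => t _; rewrite mulr_ge0// expR_ge0.
  apply: (@le_trans _ _ (expR (k 0) * \int[gam]_t (expR (L * `|t|) * G t))).
    rewrite -gaussEZ//; apply: gaussE_le; [exact: subexpM|exact: subexpZ|].
    move=> t; apply: le_trans (_ : expR (k t) * G t <= _).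
      by apply: ler_wpM2l; rewrite ?expR_ge0.
    by rewrite mulrA; apply: ler_wpM2r.
  rewrite [leRHS]mulrAC ler_pdivlMr// [leRHS]mulrC [leLHS]mulrAC.
  by apply: ler_wpM2r.
pose m := (\int[gam]_t (expR (k t) * t)) / Z.
have mm : `|m| <= m0.
  have m0E : m0 = (\int[gam]_t (expR (L * `|t|) * `|t|)) / z.
    by congr (_ / _); apply: eq_Rintegral => t _; rewrite mulrC.
  rewrite m0E ler_norml; apply/andP; split.
    rewrite /m ler_pdivlMr// mulNr lerNl -mulN1r -gaussEZ; last exact: subexpM.
    rewrite (_ : \int[gam]_t _ = \int[gam]_t (expR (k t) * (- 1 * t))); last first.
      by apply: eq_Rintegral => t _; rewrite mulrCA.
    apply: dom => //; [exact: subexpZ|exact: subexpM|].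
    by move=> t; rewrite mulN1r -normrN ler_norm.
  rewrite /m ler_pdivrMr//.
  by apply: dom => //; [exact: subexpM|move=> t; exact: ler_norm].
exists m; split => //.
move=> rho /=.
have kr : lip (L + `|rho|) (fun t => k t + rho * t).
  by apply: lipD => //; rewrite -[`|rho|]mulr1; apply: lipZ; exact: lip_id.
have skr := subexp_expR kr.
pose W := \int[gam]_t expR (k t + rho * t).
have W0 : 0 < W by exact: gaussE_expR_gt0 kr.
have sl : subexp (fun t => rho * (t - m)).
  by apply: subexpZ; apply: subexpB => //; exact: subexp_cst.
have sl1 : subexp (fun t => expR (k t) + expR (k t) * (rho * (t - m))).
  by apply: subexpD => //; exact: subexpM.
have Wm : \int[gam]_t (expR (k t) + expR (k t) * (rho * (t - m))) = Z.
  rewrite gaussED//; last exact: subexpM.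
  rewrite -/Z (_ : \int[gam]_t _ = \int[gam]_t (rho * (expR (k t) * t - m * expR (k t)))); last first.
    by apply: eq_Rintegral => t _; ring.
  rewrite gaussEZ; last by apply: subexpB; [exact: subexpM|exact: subexpZ].
  rewrite gaussEB; [|exact: subexpM|exact: subexpZ].
  rewrite gaussEZ// -/Z /m divfK ?gt_eqF// subrr mulr0 addr0//.
have We : W = expR (rho * m) * \int[gam]_t (expR (k t) * expR (rho * (t - m))).
  have lm : lip `|rho| (fun t => rho * (t - m)).
    by move=> s t; rewrite -mulrBr normrM opprB addrA subrK.
  rewrite -gaussEZ; last by apply: subexpM => //; exact: subexp_expR lm.
  by apply: eq_Rintegral => t _; rewrite -!expRD; congr expR; ring.
have lm : lip `|rho| (fun t => rho * (t - m)).
  by move=> s t; rewrite -mulrBr normrM opprB addrA subrK.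
have se := subexp_expR lm.
rewrite -/Z -/W.
have lnW : ln W - ln Z = rho * m + ln ((\int[gam]_t (expR (k t) * expR (rho * (t - m)))) / Z).
  have I0 : 0 < \int[gam]_t (expR (k t) * expR (rho * (t - m))).
    by have := W0; rewrite We pmulr_rgt0 ?expR_gt0.
  by rewrite We lnM ?posrE ?expR_gt0// expRK ln_div ?posrE// addrA.
rewrite lnW; split.
  rewrite lerDl; apply: ln_ge0; rewrite ler_pdivlMr// mul1r -[leLHS]Wm.
  apply: gaussE_le => //; first exact: subexpM.
  move=> t; rewrite -[X in X + _]mulr1 -mulrDr; apply: ler_wpM2l; first exact: expR_ge0.
  exact: expR_ge1Dx.
move=> r1; rewrite lerD2l.
have I0 : 0 < \int[gam]_t (expR (k t) * expR (rho * (t - m))).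
  by have := W0; rewrite We pmulr_rgt0 ?expR_gt0.
apply: le_trans (ln_le_subr1 _) _; first by rewrite divr_gt0.
rewrite lerBlDr ler_pdivrMr// mulrDl mul1r addrC -lerBlDl.
rewrite -[X in _ - X]Wm -gaussEB//; last exact: subexpM.
pose F (t : R) := expR (rho * (t - m)) - 1 - rho * (t - m).
pose G (t : R) := rho ^+ 2 * ((m0 + `|t|) ^+ 2 * expR (m0 + `|t|)).
rewrite (_ : \int[gam]_t _ = \int[gam]_t (expR (k t) * F t)); last first.
  by apply: eq_Rintegral => t _; rewrite /F; ring.
rewrite [leRHS](_ : _ = (\int[gam]_t (expR (L * `|t|) * G t)) / z * Z); last first.
  congr (_ * _); rewrite /C mulrC mulrA -gaussEZ//; congr (_ / _).
  by apply: eq_Rintegral => t _; rewrite /G /B; ring.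
have sF : subexp F by apply: subexpB => //; apply: subexpB => //; exact: subexp_cst.
apply: dom => //.
- rewrite (_ : (fun t => _) = fun t => rho ^+ 2 * B t); first exact: subexpZ.
  by apply/funext => t; rewrite /G /B; ring.
- move=> t; rewrite /F /G.
  have := expR_le_quadratic (rho * (t - m)).
  set q := rho * (t - m) => hq.
  have tm : `|t - m| <= m0 + `|t|.
    by apply: le_trans (ler_normB _ _) _; rewrite addrC lerD2r.
  have m1 : 0 <= m0 + `|t| by rewrite addr_ge0.
  have q1 : q ^+ 2 <= rho ^+ 2 * (m0 + `|t|) ^+ 2.
    rewrite /q exprMn; apply: ler_wpM2l; first exact: sqr_ge0.
    by rewrite -[X in X <= _]real_normK ?num_real// ler_sqr ?nnegrE.
  have q2 : `|q| <= m0 + `|t|.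
    by rewrite /q normrM; apply: le_trans tm; exact: ler_piMl.
  apply: (@le_trans _ _ (q ^+ 2 * expR `|q|)); first by rewrite -addrA -opprD lerBlDl.
  by rewrite mulrA; apply: ler_pM; rewrite ?sqr_ge0 ?expR_ge0 ?ler_expR.
- move=> t; apply: mulr_ge0; first exact: sqr_ge0.
  by apply: mulr_ge0; [exact: sqr_ge0|exact: expR_ge0].
Qed.

(** By Cameron-Martin, the increments of [glog (s *: e) g] in the direction e
    are log-Laplace transforms of a tilted Gaussian law minus a quadratic
    term; [tilted_laplace_bounds] controls them for |u| <= s, and the
    Lipschitz property for larger u. *)
Lemma glog_second_order (L s : R) : 0 <= L -> 0 < s <= 1 ->
  exists2 M, 0 <= M & forall e g x, `|e| <= 1 -> lip L g ->
  exists p : R, forall u : R,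
    `|glog (s *: e) g (x + u *: e) - glog (s *: e) g x - p * u| <= M * u ^+ 2.
Proof.
move=> L0 /andP[s0 s1].
have [m0 [C [m00 C0 H]]] := tilted_laplace_bounds L0.
pose M := (2^-1 + C + L + m0) / s ^+ 2.
exists M; first by rewrite divr_ge0 ?sqr_ge0// !addr_ge0.
move=> e g x e1 gL.
have kL' := lip_line x (s *: e) gL; set k := (fun t : R => _) in kL'.
have kL : lip L k.
  apply: lip_le kL'; apply: ler_piMr => //; rewrite normrZ (gtr0_norm s0).
  by rewrite mulr_ile1// ltW.
have [m [mm0 Hm]] := H k kL.
exists (m / s) => u.
pose rho := u / s.
have uE : u = rho * s by rewrite /rho divfK// gt_eqF.
set D0 := glog _ _ _ - glog _ _ _.
have D0E : D0 = ln (\int[gam]_t expR (k t + rho * t)) -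
      ln (\int[gam]_t expR (k t)) - rho ^+ 2 / 2.
  rewrite /D0 /glog /gmean -/k addrAC; congr (_ - _).
  have kr : lip (L + `|rho|) (fun t => k t + rho * t).
    by apply: lipD => //; rewrite -[`|rho|]mulr1; apply: lipZ; exact: lip_id.
  rewrite [RHS]addrC -(ln_gaussE_expRD _ kr); congr ln.
  have kk : lip L (fun t => k (rho + t)) by exact: lip_shift.
  rewrite [LHS](_ : _ = \int[gam]_t expR (k (rho + t))); last first.
    apply: eq_Rintegral => t _; rewrite /k; congr (expR (g _)).
    by rewrite scalerDl [rho *: _]scalerA -uE addrA.
  rewrite (gaussE_cameron_martin (- rho) kk).
  by apply: eq_Rintegral => t _; congr expR; rewrite addrA subrr add0r; field.
have [Hl Hu] := Hm rho.
have pu : m / s * u = rho * m by rewrite /rho; field; rewrite gt_eqF.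
have Mu : M * u ^+ 2 = (2^-1 + C + L + m0) * rho ^+ 2.
  by rewrite /M /rho; field; rewrite gt_eqF.
rewrite pu Mu.
have r20 : 0 <= rho ^+ 2 by exact: sqr_ge0.
have [r1|r1] := lerP `|rho| 1.
  have {}Hu := Hu r1.
  move: Hl Hu D0E; set D := (_ - ln (\int[gam]_t expR (k t))) => Hl Hu ->.
  rewrite ler_norml; clear -Hl Hu r20 C0 L0 m00.
  have h1 : 0 <= C * rho ^+ 2 by rewrite mulr_ge0.
  have h2 : 0 <= L * rho ^+ 2 by rewrite mulr_ge0.
  have h3 : 0 <= m0 * rho ^+ 2 by rewrite mulr_ge0.
  by apply/andP; split; lra.
have rr : `|rho| <= rho ^+ 2.
  by rewrite -[rho ^+ 2]real_normK ?num_real// expr2 ler_peMl// ltW.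
have D0L : `|D0| <= L * `|rho|.
  apply: le_trans (glog_lip _ gL _ _) _; rewrite addrAC subrr add0r normrZ.
  apply: ler_wpM2l => //; apply: le_trans (ler_piMr _ e1) _ => //.
  by rewrite uE normrM (gtr0_norm s0); exact: ler_piMr.
apply: le_trans (ler_normB _ _) _; rewrite normrM.
apply: (@le_trans _ _ (L * rho ^+ 2 + m0 * rho ^+ 2)).
  apply: lerD; first by apply: le_trans D0L _; exact: ler_wpM2l.
  by rewrite mulrC; exact: ler_pM.
rewrite -mulrDl; apply: ler_wpM2r => //.
by rewrite -[leRHS]addrA lerDr addr_ge0.
Qed.

End gauss_smoothing.

(** * The one-dimensional inequality *)
Section gauss_semigroup.
Context {R : realType} {V : normedModType R}.
Implicit Types (e x y z : V) (a b f g h F : V -> R).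
Local Notation gam := (@normal_prob R 0 1).

Lemma gmean_semigroup_ge0 F e x (s t : R) : 0 < s -> 0 < t ->
  (forall x, 0 <= F x) -> (forall x e, subexp (fun t : R => F (x + t *: e))) ->
  gmean (Num.sqrt s *: e) (gmean (Num.sqrt t *: e) F) x =
  gmean (Num.sqrt (s + t) *: e) F x.
Proof.
move=> s0 t0 F0 sF.
have st0 : 0 < s + t by rewrite addr_gt0.
have c2 : Num.sqrt (s + t) ^+ 2 = Num.sqrt s ^+ 2 + Num.sqrt t ^+ 2.
  by rewrite !sqr_sqrtr// ltW.
pose k (u : R) := F (x + u *: e).
have sk : subexp k by exact: sF.
rewrite /gmean /Rintegral; congr fine.
transitivity (\int[gam]_u \int[gam]_v (k (0 + Num.sqrt s * u + Num.sqrt t * v))%:E)%E.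
  apply: eq_integral => u _; rewrite fineK; last first.
    apply: integrable_fin_num => //.
    exact: (subexp_integrable (sF (x + u *: (Num.sqrt s *: e)) (Num.sqrt t *: e))).
  apply: eq_integral => v _; rewrite /k add0r; congr (F _)%:E.
  by rewrite !scalerA scalerDl addrA [_ * Num.sqrt s]mulrC [_ * Num.sqrt t]mulrC.
rewrite (@integral_normal_convolution _ _ _ _ (Num.sqrt (s + t))) ?sqrtr_gt0//; first last.
- by move=> u; exact: F0.
- by case: sk.
apply: eq_integral => u _; rewrite /k add0r; congr (F _)%:E.
by rewrite scalerA mulrC.
Qed.

Lemma glog_semigroup L f e (s t : R) : 0 <= s -> 0 <= t -> lip L f ->
  glog (Num.sqrt s *: e) (glog (Num.sqrt t *: e) f) = glog (Num.sqrt (s + t) *: e) f.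
Proof.
move=> s0 t0 fL.
have [->|s1] := eqVneq s 0; first by rewrite sqrtr0 scale0r glog0 add0r.
have [->|t1] := eqVneq t 0; first by rewrite sqrtr0 scale0r glog0 addr0.
apply/funext => x; rewrite {1 3}/glog; congr ln.
rewrite -(@gmean_semigroup_ge0 _ _ _ s t) ?lt_neqAle ?s0 ?t0 ?[0 == _]eq_sym ?s1 ?t1//.
- by congr (gmean _ _ x); apply/funext => y; rewrite (expR_glog _ _ fL).
- by move=> y e'; exact: subexp_expR_line fL.
Qed.

Lemma gmean_semigroup L f e (s t : R) : 0 <= s -> 0 <= t -> lip L f ->
  gmean (Num.sqrt s *: e) (gmean (Num.sqrt t *: e) f) = gmean (Num.sqrt (s + t) *: e) f.
Proof.
move=> s0 t0 fL; apply/funext => x.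
have g0 (g : V -> R) : gmean 0 g = g by apply/funext => y; exact: gmean0.
have [->|s1] := eqVneq s 0; first by rewrite sqrtr0 scale0r g0 add0r.
have [->|t1] := eqVneq t 0; first by rewrite sqrtr0 scale0r g0 addr0.
have {s0}s0 : 0 < s by rewrite lt_neqAle eq_sym s1.
have {t0}t0 : 0 < t by rewrite lt_neqAle eq_sym t1.
(* the Tonelli argument needs a nonnegative function: add exp |f| to f *)
pose k y := `|f y|.
have kL : lip L k by exact: lip_normr.
have fk y : - f y <= expR (k y).
  by apply: le_trans (ler_expR_id _); rewrite /k -normrN; exact: ler_norm.
pose F y := f y + expR (k y).
have F0 y : 0 <= F y by rewrite /F -lerBlDl sub0r.
have sF y e' : subexp (fun t : R => F (y + t *: e')).
  by apply: subexpD; [exact: subexp_line fL|exact: subexp_expR_line kL].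
have FE e' : gmean e' F = fun y => gmean e' f y + expR (glog e' k y).
  apply/funext => y; rewrite (expR_glog _ _ kL) /gmean gaussED//.
    exact: subexp_line fL.
  exact: subexp_expR_line kL.
have := gmean_semigroup_ge0 e x s0 t0 F0 sF.
rewrite !FE {1}/gmean gaussED; [|exact: subexp_line (gmean_lip _ fL)|
  exact: subexp_expR_line (glog_lip _ kL)].
rewrite -/(gmean _ (gmean _ _) x).
rewrite -[X in _ + X = _](expR_glog (Num.sqrt s *: e) x (glog_lip (Num.sqrt t *: e) kL)).
by rewrite (glog_semigroup _ (ltW s0) (ltW t0) kL) => /addIr.
Qed.

(** The hypothesis of the functional inequality, with an additive error. *)
Definition interp (lam err : R) a b h :=
  forall x y, b x + lam ^+ 2 * h y - err <= a ((1 - lam) *: x + lam *: y).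

(** One step of variance eps with zero drift, then N + 1 steps of variance dl
    with drift given by the slope of the current h. The semigroup property shows that after
    k of them each function has undergone a single step of variance
    v k = eps + k dl, and that the smoothing of [glog_second_order] with
    variance eps is still available. *)
Lemma interp_gauss_err (lam L eps : R) e a b h :
  0 <= lam -> 0 <= L -> `|e| <= 1 -> 0 < eps < 1 ->
  lip L a -> lip L b -> lip L h -> interp lam 0 a b h ->
  exists2 C, 0 <= C & forall N : nat,
    interp lam (lam ^+ 2 * (eps * err_lip L + C / N.+1%:R))
      (glog e a) (gmean e b) (glog e h).
Proof.
move=> lam0 L0 e1 /andP[e0 e2] aL bL hL H.
have s0 : 0 < Num.sqrt eps <= 1.
  by rewrite sqrtr_gt0 e0 -[leRHS]sqrtr1 ler_wsqrtr// ltW.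
have [M M0 HM] := @glog_second_order R V L (Num.sqrt eps) L0 s0.
have C0 : 0 <= err_smooth L M.
  apply: Rintegral_ge0 => t _; apply: mulr_ge0; [exact: sqr_ge0|exact: expR_ge0].
exists (err_smooth L M) => // N.
pose dl := (1 - eps) / N.+1%:R.
have N0 : 0 < N.+1%:R :> R by rewrite ltr0n.
have dl0 : 0 < dl by rewrite divr_gt0// subr_gt0.
have dl1 : dl <= 1.
  rewrite ler_pdivrMr// mul1r; apply: (@le_trans _ _ 1); last by rewrite ler1n.
  by rewrite lerBlDr lerDl ltW.
pose v (k : nat) := eps + k%:R * dl.
have v0 k : 0 <= v k by rewrite addr_ge0 ?(ltW e0)// mulr_ge0// ltW.
have Hk k : interp lam (lam ^+ 2 * (eps * err_lip L + k%:R * (dl ^+ 2 * err_smooth L M)))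
    (glog (Num.sqrt (v k) *: e) a) (gmean (Num.sqrt (v k) *: e) b)
    (glog (Num.sqrt (v k) *: e) h).
  elim: k => [|k IH] x y.
    rewrite /v mul0r addr0 mul0r addr0.
    have st := glog_step 0 (Num.sqrt eps *: e) x y lam0 aL bL hL H.
    have er := @glog_err_lip R V L h e y (Num.sqrt eps) L0 hL e1.
    have {}er := er _; have := er; rewrite (ltW (andP s0).1) (andP s0).2 => /(_ isT).
    rewrite sqr_sqrtr ?(ltW e0)// => {}er.
    apply: le_trans st; rewrite subr0.
    have := ler_wpM2l (sqr_ge0 lam) er.
    set A := glog _ h y; set I := \int[_]_t _; set J := err_lip L.
    set G := gmean _ b x.
    by rewrite mulrDr mulrBr; move: (lam ^+ 2) A I J G => l A I J G; lra.
  have akL := glog_lip (Num.sqrt (v k) *: e) aL.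
  have bkL := gmean_lip (Num.sqrt (v k) *: e) bL.
  have hkL := glog_lip (Num.sqrt (v k) *: e) hL.
  have vS : v k.+1 = dl + v k by rewrite /v -[k.+1%:R]natr1; ring.
  have vk : v k = eps + k%:R * dl by [].
  have [p Hp] := HM e (glog (Num.sqrt (k%:R * dl) *: e) h) y e1 (glog_lip _ hL).
  rewrite (glog_semigroup _ (ltW e0) _ hL) -?vk in Hp; last by rewrite mulr_ge0// ltW.
  have sd : 0 <= Num.sqrt dl <= 1.
    by rewrite sqrtr_ge0 -[leRHS]sqrtr1 ler_wsqrtr.
  have [r er] := glog_err_smooth L0 M0 hkL e1 sd Hp.
  have st := glog_step r (Num.sqrt dl *: e) x y lam0 akL bkL hkL IH.
  move: st er; rewrite (glog_semigroup _ (ltW dl0) (v0 k) aL).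
  rewrite (gmean_semigroup _ (ltW dl0) (v0 k) bL).
  rewrite (glog_semigroup _ (ltW dl0) (v0 k) hL) -vS => st er.
  apply: le_trans st.
  rewrite (_ : Num.sqrt dl ^+ 4 = dl ^+ 2) in er; last first.
    by rewrite -[4%N]/(2 * 2)%N exprM sqr_sqrtr// ltW.
  have := ler_wpM2l (sqr_ge0 lam) er.
  set A := glog _ h y; set I := \int[_]_t _; set J := err_lip L.
  set G := gmean _ b x; set S := err_smooth L M.
  rewrite -[k.+1%:R]natr1 mulrDr mulrBr.
  by move: (lam ^+ 2) A I J G S (dl ^+ 2) k%:R => l A I J G S d2 kk; nra.
have := Hk N.+1.
have -> : v N.+1 = 1 by rewrite /v mulrC /dl divfK ?gt_eqF// addrC subrK.
rewrite sqrtr1 scale1r => HN x y; apply: le_trans (HN x y).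
rewrite lerD2l lerN2; apply: ler_wpM2l; first exact: sqr_ge0.
rewrite lerD2l mulrA mulrC; apply: ler_wpM2l => //.
have e3 : 1 - eps <= 1 by rewrite lerBlDr lerDl ltW.
have dN : dl <= N.+1%:R^-1 by apply: ler_piMl => //; rewrite invr_ge0 ltW.
apply: le_trans dN; rewrite expr2 mulrA.
have -> : N.+1%:R * dl = 1 - eps by rewrite mulrC divfK ?gt_eqF.
by apply: ler_piMl => //; exact: ltW.
Qed.

Theorem interp_gauss (lam L : R) e a b h :
  0 <= lam -> 0 <= L -> `|e| <= 1 ->
  lip L a -> lip L b -> lip L h -> interp lam 0 a b h ->
  interp lam 0 (glog e a) (gmean e b) (glog e h).
Proof.
move=> lam0 L0 e1 aL bL hL H x y; rewrite subr0.
apply/ler_addgt0Pr => eta eta0.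
have E0 : 0 <= err_lip L.
  apply: Rintegral_ge0 => t _; apply: mulr_ge0; [exact: sqr_ge0|exact: expR_ge0].
have l0 : 0 <= lam ^+ 2 by exact: sqr_ge0.
pose D := lam ^+ 2 * err_lip L + 1.
have D0 : 0 < D by rewrite ltr_wpDl// mulr_ge0.
pose eps := Num.min 2^-1 (eta / 2 / D).
have eps0 : 0 < eps by rewrite lt_min invr_gt0 ltr0n/= !divr_gt0// ltr0n.
have eps1 : eps < 1 by rewrite gt_min; apply/orP; left; lra.
have epsD : eps * (lam ^+ 2 * err_lip L) <= eta / 2.
  apply: (@le_trans _ _ (eta / 2 / D * D)); last by rewrite divfK ?gt_eqF.
  apply: ler_pM; rewrite ?(ltW eps0) ?mulr_ge0//.
    by rewrite ge_min lexx orbT.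
  by rewrite /D lerDl.
have [C C0 HC] := interp_gauss_err lam0 L0 e1 (introT andP (conj eps0 eps1)) aL bL hL H.
have [N HN] : exists N : nat, lam ^+ 2 * C / N.+1%:R <= eta / 2.
  exists (Num.truncn ((eta / 2)^-1 * (lam ^+ 2 * C))).
  rewrite ler_pdivrMr ?ltr0n// -ler_pdivrMl ?divr_gt0//.
  by apply/ltW; exact: truncnS_gt.
have := HC N x y.
have -> : lam ^+ 2 * (eps * err_lip L + C / N.+1%:R) =
  eps * (lam ^+ 2 * err_lip L) + lam ^+ 2 * C / N.+1%:R by ring.
move: (gmean e b x) (glog e h y) (glog e a _) epsD HN.
move: (eps * (lam ^+ 2 * err_lip L)) (lam ^+ 2 * C / N.+1%:R) => A B G1 G2 G3.
by move: (lam ^+ 2 * G2) => G4; lra.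
Qed.

End gauss_semigroup.

(** * Borel sets of row vectors *)
Section borel_row_vectors.
Context {R : realType}.

Definition box n (A : 'I_n -> set R) : set 'rV[R]_n :=
  [set x | forall j, A j (x ord0 j)].

Definition boxes n : set (set 'rV[R]_n) :=
  [set B | exists2 A : 'I_n -> set R, (forall j, measurable (A j)) & B = box A].
Arguments boxes n : clear implicits.

Lemma continuous_borel_measurable n (f : 'rV[R]_n -> R) : continuous f ->
  measurable_fun [set: borel_rV R n] (f : borel_rV R n -> R).
Proof.
move=> cf; apply: (measurability _ (RGenOpens.measurableE R)).
move=> _ [_ [a [b ->]] <-]; rewrite setTI; apply: sub_sigma_algebra.
by move/continuousP : cf; apply; exact: interval_open.
Qed.

(** An open set is the union of the cubes with rational centre and radius
    1 / (m + 1) that it contains. *)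
Lemma open_boxes n (U : set 'rV[R]_n) : open U -> <<s boxes n >> U.
Proof.
move=> oU; pose F (i : 'rV[rat]_n * nat) : set 'rV[R]_n :=
  box (fun j => ball (ratr (i.1 ord0 j) : R) i.2.+1%:R^-1).
pose G i := if `[< F i `<=` U >] then F i else set0.
have -> : U = \bigcup_i G i.
  rewrite eqEsubset; split => [x Ux|x [i _]]; last first.
    by rewrite /G; case: asboolP => // FU /FU.
  have [e e0 eU] : exists2 e : R, 0 < e & ball x e `<=` U.
    have /nbhs_ballP[e /= e0 eU] : nbhs x U by exact: open_nbhs_nbhs.
    by exists e.
  have [m me] : exists m : nat, m.+1%:R^-1 < e / 2.
    exists (Num.truncn (e / 2)^-1).
    rewrite invf_plt ?posrE ?ltr0n ?divr_gt0//; exact: truncnS_gt.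
  have [q Hq] : exists q : 'rV[rat]_n, forall j, `|ratr (q ord0 j) - x ord0 j| < m.+1%:R^-1.
    have H j : exists q : rat, `|ratr q - x ord0 j| < m.+1%:R^-1.
      have : x ord0 j < x ord0 j + m.+1%:R^-1 by rewrite ltrDl invr_gt0.
      move=> /rat_in_itvoo[q]; rewrite in_itv/= => /andP[q1 q2].
      by exists q; rewrite ger0_norm ?subr_ge0 ?ltW// ltrBlDl.
    by exists (\row_j projT1 (cid (H j))) => j; rewrite mxE; case: cid.
  have Fx : F (q, m) x by move=> j; rewrite /= /ball/=; exact: Hq.
  have FU : F (q, m) `<=` U.
    move=> y Fy; apply: eU; rewrite /ball/=; split => // i j; rewrite ord1.
    have := Fy j; have := Hq j; rewrite /= /ball/= => h1 h2.
    rewrite -(subrK (ratr (q ord0 j)) (x ord0 j)) -addrA.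
    apply: le_lt_trans (ler_normD _ _) _; rewrite distrC.
    by rewrite [ltRHS](splitr e); apply: ltrD; apply: lt_trans me.
  by exists (q, m) => //; rewrite /G; case: asboolP.
apply: (@countable_bigcupT_measurable _ (g_sigma_algebraType (boxes n))) => [|i].
  exact: countableP.
rewrite /G; case: asboolP => _; last exact: measurable0.
apply: sub_sigma_algebra; exists (fun j => ball (ratr (i.1 ord0 j) : R) i.2.+1%:R^-1) => // j.
exact: measurable_ball.
Qed.

Lemma borel_boxes n : @measurable _ (borel_rV R n) = <<s boxes n >>.
Proof.
rewrite eqEsubset; split; apply: smallest_sub; try exact: smallest_sigma_algebra.
  by move=> U; exact: open_boxes.
move=> _ [A mA ->].
rewrite (_ : box A = \bigcap_(j in [set: 'I_n]) ((fun x : borel_rV R n => x ord0 j) @^-1` A j)); last first.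
  by rewrite eqEsubset; split => [x Ax j _|x Ax j]; [exact: Ax|exact: Ax j I].
apply: fin_bigcap_measurable => //.
move=> j _; rewrite -[X in measurable X]setTI.
by apply: continuous_borel_measurable => //; exact: coord_continuous.
Qed.

Lemma measurable_borel_rV d (T : measurableType d) n (f : T -> borel_rV R n) :
  (forall j, measurable_fun setT (fun w => f w ord0 j)) -> measurable_fun setT f.
Proof.
move=> mf; apply: (measurability _ (borel_boxes n)).
move=> _ [_ [A mA ->] <-]; rewrite setTI.
rewrite (_ : _ @^-1` _ = \bigcap_(j in [set: 'I_n]) ((fun w => f w ord0 j) @^-1` A j)); last first.
  by rewrite eqEsubset; split => [x Ax j _|x Ax j]; [exact: Ax|exact: Ax j I].
apply: fin_bigcap_measurable => //.
by move=> j _; rewrite -[X in measurable X]setTI; exact: mf.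
Qed.

End borel_row_vectors.

(** * Integrating out the coordinates of a Gaussian vector *)
Section coordinate_disintegration.
Context (R : realType) (n : nat) d (T : measurableType d) (P : probability T R)
  (Z : {RV P >-> borel_rV R n}) (hZ : std_gaussian_vector Z).
Local Notation gam := (@normal_prob R 0 1).

(** [truncate k] keeps the first k coordinates, so that passing from k + 1 to k
    integrates out one coordinate without changing the type of the vector. *)
Definition truncate (k : nat) (x : 'rV[R]_n) : 'rV[R]_n :=
  \row_j (if (j < k)%N then x ord0 j else 0).

Let coord (j : 'I_n) (w : T) : R := (Z w : 'rV[R]_n) ord0 j.

Let measurable_coord j : measurable_fun setT (coord j).
Proof.
apply: (@measurableT_comp _ _ _ _ _ _ (fun x : borel_rV R n => x ord0 j)) => //.
by apply: continuous_borel_measurable; exact: coord_continuous.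
Qed.

Lemma measurable_truncate k :
  measurable_fun setT (fun w => truncate k (Z w) : borel_rV R n).
Proof.
apply: measurable_borel_rV => j.
rewrite (_ : (fun w => _) = fun w => if (j < k)%N then coord j w else 0); last first.
  by apply/funext => w; rewrite mxE.
by case: (j < k)%N => //; exact: measurable_coord.
Qed.

Let coord_prob j B : measurable B -> P (coord j @^-1` B) = gam B.
Proof. by move=> mB; exact: (hZ.2 j B mB). Qed.

Let truncZ k : {mfun T >-> borel_rV R n} := mfun_Sub (mem_set (measurable_truncate k)).

(** If 0 lies in every A j with k <= j, both sides are instances of the product
    rule; otherwise the box is never reached. *)
Let truncate_box_indep (k : 'I_n) A (B : set R) :
  (forall j, measurable (A j)) -> measurable B ->
  P (truncZ k @^-1` box A `&` coord k @^-1` B) =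
  (gam B * P (truncZ k @^-1` box A))%E.
Proof.
move=> mA mB.
have [zA|zA] := pselect (forall j : 'I_n, (k <= j)%N -> A j 0); last first.
  rewrite (_ : truncZ k @^-1` box A = set0) ?set0I ?measure0 ?mule0//.
  rewrite -subset0 => w /= Aw; apply: zA => j kj.
  by have := Aw j; rewrite mxE ltnNge kj.
pose J := [set j : 'I_n | (j < k)%N]%SET.
have kJ : k \notin J by rewrite inE ltnn.
have boxE : truncZ k @^-1` box A = \bigcap_(j in [set` J]) (coord j @^-1` A j).
  rewrite eqEsubset; split => w /=.
    by move=> Aw j; rewrite /= inE => jk; have := Aw j; rewrite mxE jk.
  move=> Aw j; rewrite mxE; case: ifPn => jk; last by apply: zA; rewrite leqNgt.
  by have := Aw j; rewrite /= inE; exact.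
pose A' j := if j == k then B else A j.
have mA' j : measurable (A' j) by rewrite /A'; case: ifP.
have -> : truncZ k @^-1` box A `&` coord k @^-1` B =
    \bigcap_(j in [set` (k |: J)%SET]) (coord j @^-1` A' j).
  rewrite boxE eqEsubset; split => w /=.
    move=> [Aw Bw] j; rewrite /= /A'; case: eqVneq => [->//|jk].
    by rewrite in_setU1 (negbTE jk)/=; exact: Aw.
  move=> Aw; split.
    move=> j /= jJ; have := Aw j; rewrite /= /A' in_setU1 jJ orbT => /(_ isT).
    by case: eqVneq jJ => // ->; rewrite (negbTE kJ).
  by have := Aw k; rewrite /= /A' in_setU1 eqxx; exact.
have mcoord j C : measurable C -> P (coord j @^-1` C) \is a fin_num.
  by move=> mC; apply: fin_num_measure; rewrite -[X in measurable X]setTI; exact: measurable_coord.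
rewrite boxE; have [+ _] := hZ => indep.
rewrite (indep (k |: J)%SET A')//.
rewrite (indep J A)// big_setU1//=.
rewrite /A' eqxx -(coord_prob k mB) EFinM fineK ?mcoord//; congr (_ * _%:E)%E.
by apply: eq_bigr => j jJ; case: eqVneq jJ => // ->; rewrite (negbTE kJ).
Qed.

(** Both sides are finite measures in A, and they agree on boxes. *)
Let truncate_indep (k : 'I_n) (A : set (borel_rV R n)) (B : set R) :
  measurable A -> measurable B ->
  P (truncZ k @^-1` A `&` coord k @^-1` B) =
  (gam B * P (truncZ k @^-1` A))%E.
Proof.
move=> mA mB.
have mkB : measurable (coord k @^-1` B).
  by rewrite -[X in measurable X]setTI; exact: measurable_coord.
have gB0 : 0 <= fine (gam B) by rewrite fine_ge0.
have mtk : measurable_fun setT (truncZ k) by exact: measurable_truncate.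
pose m1' : {measure set (borel_rV R n) -> \bar R} := pushforward (mrestr P mkB) (truncZ k).
pose m1 := m1' mtk.
pose m2 : {measure set (borel_rV R n) -> \bar R} :=
  mscale (NngNum gB0) (distribution P (truncZ k)).
have -> : (gam B * P (truncZ k @^-1` A))%E = m2 A.
  by rewrite /m2 /= /mscale/= fineK// fin_num_measure.
rewrite -[LHS]/(m1 A).
apply: (@measure_unique _ R (borel_rV R n) (@boxes R n) (fun=> setT) (borel_boxes n) _ _ _ m1 m2) => //.
- move=> _ _ [A1 mA1 ->] [A2 mA2 ->]; exists (fun j => A1 j `&` A2 j).
    by move=> j; exact: measurableI.
  rewrite eqEsubset; split => x /=; first by move=> [h1 h2] j; split; [exact: h1|exact: h2].
  by move=> h; split=> j; have [] := h j.
- move=> _; exists (fun=> setT) => //.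
  by rewrite eqEsubset; split.
- exact: bigcup_const.
- move=> _ [C mC ->]; rewrite /m2 /= /mscale/= fineK ?fin_num_measure//.
  exact: truncate_box_indep.
- move=> _; rewrite /m1 /= /pushforward /mrestr preimage_setT setTI.
  by apply: le_lt_trans (probability_le1 P mkB) _; rewrite ltry.
Qed.

Lemma measurable_add_delta (k : 'I_n) :
  measurable_fun setT (fun z : borel_rV R n * measurableTypeR R =>
    (z.1 : 'rV[R]_n) + z.2 *: delta_mx ord0 k : borel_rV R n).
Proof.
apply: measurable_borel_rV => j.
rewrite (_ : (fun z => _) = fun z : borel_rV R n * measurableTypeR R =>
   (z.1 : 'rV[R]_n) ord0 j + z.2 * (delta_mx ord0 k : 'rV[R]_n) ord0 j); last first.
  by apply/funext => z; rewrite !mxE.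
apply: measurable_funD; last exact: measurable_funM.
apply: (@measurableT_comp _ _ _ _ _ _ (fun x : borel_rV R n => x ord0 j)) => //.
by apply: continuous_borel_measurable; exact: coord_continuous.
Qed.

Lemma truncateS (k : 'I_n) x :
  truncate k.+1 x = truncate k x + x ord0 k *: delta_mx ord0 k.
Proof.
apply/rowP => j; rewrite !mxE/= ltnS leq_eqVlt.
have [->|jk] := eqVneq j k; first by rewrite eqxx ltnn add0r mulr1.
by rewrite mulr0 addr0; case: eqP => // /val_inj jk'; rewrite jk' eqxx in jk.
Qed.

(** Fubini for the law of (truncate k Z, Z_k), which is a product measure. *)
Lemma integral_truncateS (k : 'I_n) (F : borel_rV R n -> \bar R) :
  measurable_fun setT F -> (forall x, 0 <= F x)%E ->
  (\int[P]_w F (truncate k.+1 (Z w)) =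
   \int[P]_w \int[gam]_t F (truncate k (Z w) + t *: delta_mx ord0 k)%R)%E.
Proof.
move=> mF F0.
pose phi (z : borel_rV R n * measurableTypeR R) : borel_rV R n :=
  (z.1 : 'rV[R]_n) + z.2 *: delta_mx ord0 k.
have mphi : measurable_fun setT phi by exact: measurable_add_delta.
have mpair : measurable_fun setT (fun w => (truncZ k w, coord k w : measurableTypeR R)).
  by apply: measurable_fun_pair => //; exact: measurable_coord.
pose pairZ : {mfun T >-> (borel_rV R n * measurableTypeR R)%type} := mfun_Sub (mem_set mpair).
transitivity (\int[P]_w (F \o phi) (pairZ w))%E.
  by apply: eq_integral => w _; rewrite /= /phi/= truncateS.
have mFphi : measurable_fun setT (F \o phi) by exact: measurableT_comp.
rewrite -(@ge0_integral_distribution _ _ _ _ _ P pairZ (F \o phi))//; last by move=> y; exact: F0.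
pose m1 := distribution P (truncZ k).
rewrite (@eq_measure_integral _ _ _ _ (m1 \x gam)%E); last first.
  move=> A mA _; apply/esym; apply: product_measure_unique => // B C mB mC.
  by rewrite muleC; exact: truncate_indep.
have FF0 z : (0 <= (F \o phi) z)%E by exact: F0.
rewrite fubini_tonelli1//.
rewrite (@ge0_integral_distribution _ _ _ _ _ P (truncZ k))//.
- exact: (measurable_fun_fubini_tonelli_F (F \o phi)).
- by move=> x; apply: integral_ge0 => t _; exact: FF0.
Qed.

End coordinate_disintegration.

(** * The functional inequality for Gaussian vectors *)
Lemma rV_norm_le (R : realType) n (x : 'rV[R]_n) (c : R) : 0 <= c ->
  (forall j, `|x ord0 j| <= c) -> `|x| <= c.
Proof.
move=> c0 xc; rewrite /Num.norm /= mx_normrE; apply/bigmax_leP; split => // -[i j] _ /=.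
by rewrite ord1.
Qed.

Lemma rV_coord_le (R : realType) n (x : 'rV[R]_n) j : `|x ord0 j| <= `|x|.
Proof.
by rewrite [leRHS]/Num.norm /= mx_normrE; apply/bigmax_geP; right => /=; exists (ord0, j).
Qed.

Section gaussian_tensorization.
Context (R : realType) (n : nat) d (T : measurableType d) (P : probability T R)
  (Z : {RV P >-> borel_rV R n}) (hZ : std_gaussian_vector Z).
Local Notation gam := (@normal_prob R 0 1).
Implicit Types (a b f h F : 'rV[R]_n -> R).

Lemma norm_delta_mx_le1 (k : 'I_n) : `|delta_mx ord0 k : 'rV[R]_n| <= 1.
Proof.
apply: rV_norm_le => // j; rewrite mxE.
by case: (_ && _); rewrite ?normr0 ?normr1.
Qed.

Lemma measurable_lip_truncate L f k : lip L f ->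
  measurable_fun setT (fun w => f (truncate k (Z w))).
Proof.
move=> fL; apply: (@measurableT_comp _ _ _ _ _ _ (f : borel_rV R n -> R)).
  by apply: continuous_borel_measurable; exact: lip_continuous fL.
exact: measurable_truncate.
Qed.

Lemma integral_gmean (k : 'I_n) F : continuous F -> (forall x, 0 <= F x) ->
  (forall x e, subexp (fun t : R => F (x + t *: e))) ->
  (\int[P]_w (F (truncate k.+1 (Z w)))%:E =
   \int[P]_w (gmean (delta_mx ord0 k) F (truncate k (Z w)))%:E)%E.
Proof.
move=> cF F0 sF.
rewrite (integral_truncateS hZ k (F := fun x => (F x)%:E)); last 2 first.
- by apply/measurable_EFinP; exact: continuous_borel_measurable.
- by move=> x; rewrite lee_fin.
apply: eq_integral => w _; rewrite fineK//.
apply: integrable_fin_num => //.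
exact: subexp_integrable (sF _ _).
Qed.

Lemma integral_glog (k : 'I_n) L f : lip L f ->
  (\int[P]_w (expR (f (truncate k.+1 (Z w))))%:E =
   \int[P]_w (expR (glog (delta_mx ord0 k) f (truncate k (Z w))))%:E)%E.
Proof.
move=> fL; rewrite (@integral_gmean k (fun x => expR (f x))).
- by apply: eq_integral => w _; rewrite (expR_glog _ _ fL).
- move=> x; apply: continuous_comp; last exact: continuous_expR.
  exact: lip_continuous fL x.
- by move=> x; exact: expR_ge0.
- by move=> x e; exact: subexp_expR_line fL.
Qed.

Lemma truncate0 (x : 'rV[R]_n) : truncate 0 x = 0.
Proof. by apply/rowP => j; rewrite !mxE. Qed.

Lemma truncate_id (x : 'rV[R]_n) : truncate n x = x.
Proof. by apply/rowP => j; rewrite mxE ltn_ord. Qed.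

Lemma integrable_expR_lip_truncate k L f : (k <= n)%N -> lip L f ->
  P.-integrable setT (EFin \o (fun w => expR (f (truncate k (Z w))))).
Proof.
move=> kn fL; apply/integrableP; split.
  apply/measurable_EFinP; apply: measurableT_comp => //.
  exact: measurable_lip_truncate fL.
under eq_integral do rewrite /= ger0_norm ?expR_ge0//.
elim: k kn f fL => [_ f fL|k IH kn f fL].
  under eq_integral do rewrite truncate0.
  apply: (@le_lt_trans _ _ ((expR (f 0))%:E * P setT)%E).
    by rewrite -integral_cst.
  by rewrite probability_setT mule1 ltry.
rewrite (@integral_glog (Ordinal kn) L f fL).
by apply: IH (ltnW kn) _ (glog_lip _ fL).
Qed.

Lemma integrable_lip_truncate k L f : (k <= n)%N -> lip L f ->
  P.-integrable setT (EFin \o (fun w => f (truncate k (Z w)))).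
Proof.
move=> kn fL.
apply: le_integrable (integrable_expR_lip_truncate kn (lip_normr fL)) => //.
  by apply/measurable_EFinP; exact: measurable_lip_truncate fL.
move=> w _; rewrite /= lee_fin [leRHS]ger0_norm ?expR_ge0//.
exact: ler_expR_id.
Qed.

Lemma Rintegral_gmean (k : 'I_n) L f : lip L f ->
  \int[P]_w f (truncate k.+1 (Z w)) =
  \int[P]_w gmean (delta_mx ord0 k) f (truncate k (Z w)).
Proof.
move=> fL; set e := delta_mx ord0 k.
(* as for [gmean_semigroup], exp |f| is added to make f nonnegative *)
pose g (x : 'rV[R]_n) : R := `|f x|.
have gL : lip L g by exact: lip_normr.
have fg x : - f x <= expR (g x).
  by apply: le_trans (ler_expR_id _); rewrite /g -normrN; exact: ler_norm.
pose F x := f x + expR (g x).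
have sF y e' : subexp (fun t : R => F (y + t *: e')).
  by apply: subexpD; [exact: subexp_line fL|exact: subexp_expR_line gL].
have cF : continuous F.
  move=> x; apply: (@continuousD _ R^o _ f (fun x => expR (g x))).
    exact: (lip_continuous fL).
  by apply: continuous_comp; [exact: lip_continuous gL x|exact: continuous_expR].
have F0 y : 0 <= F y by rewrite /F -lerBlDl sub0r.
have FE : gmean e F = fun y => gmean e f y + expR (glog e g y).
  apply/funext => y; rewrite (expR_glog _ _ gL) /gmean gaussED//.
    exact: subexp_line fL.
  exact: subexp_expR_line gL.
have kn : (k.+1 <= n)%N by exact: ltn_ord.
have kn' : (k <= n)%N by exact: ltnW.
have := congr1 fine (integral_gmean k cF F0 sF).
rewrite -/(Rintegral _ _ _) -/(Rintegral _ _ _) FE.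
rewrite {1}/F RintegralD//; last 2 first.
- exact: integrable_lip_truncate fL.
- exact: integrable_expR_lip_truncate gL.
rewrite RintegralD//; last 2 first.
- exact: integrable_lip_truncate (gmean_lip _ fL).
- exact: integrable_expR_lip_truncate (glog_lip _ gL).
rewrite [X in _ + X = _](_ : _ = \int[P]_w expR (glog e g (truncate k (Z w)))); first exact: addIr.
by rewrite /Rintegral (integral_glog k gL).
Qed.

(** Induction on the number of coordinates: integrating out one of them turns
    a, b, h into Lipschitz functions that satisfy the same hypothesis, by
    [interp_gauss]. *)
Theorem interp_gaussian_vector (lam L : R) a b h : 0 <= lam -> 0 <= L ->
  lip L a -> lip L b -> lip L h -> interp lam 0 a b h ->
  \int[P]_w b (Z w) + lam ^+ 2 * ln (\int[P]_w expR (h (Z w))) <=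
  ln (\int[P]_w expR (a (Z w))).
Proof.
move=> lam0 L0; have := leqnn n.
suff H k : (k <= n)%N -> forall a b h, lip L a -> lip L b -> lip L h ->
    interp lam 0 a b h ->
    \int[P]_w b (truncate k (Z w)) + lam ^+ 2 * ln (\int[P]_w expR (h (truncate k (Z w)))) <=
    ln (\int[P]_w expR (a (truncate k (Z w)))).
  move=> nn aL bL hL abh; have := H n nn a b h aL bL hL abh.
  have E (g : 'rV[R]_n -> R) : \int[P]_w g (truncate n (Z w)) = \int[P]_w g (Z w).
    by apply: eq_Rintegral => w _; rewrite truncate_id.
  by rewrite (E b) (E (fun x => expR (a x))) (E (fun x => expR (h x))).
elim: k => [_|k IH kn] {}a {}b {}h aL bL hL abh.
  have E (g : 'rV[R]_n -> R) : \int[P]_w g (truncate 0 (Z w)) = g 0.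
    under eq_Rintegral do rewrite truncate0.
    exact: Rintegral_cst1.
  rewrite (E b) (E (fun x => expR (a x))) (E (fun x => expR (h x))) !expRK.
  by have := abh 0 0; rewrite subr0 !scaler0 addr0.
pose k' := Ordinal kn.
rewrite (@Rintegral_gmean k' L)// /Rintegral.
rewrite (@integral_glog k' L a aL) (@integral_glog k' L h hL).
apply: (IH (ltnW kn)).
- exact: glog_lip.
- exact: gmean_lip.
- exact: glog_lip.
- exact: (interp_gauss lam0 L0 (norm_delta_mx_le1 k')).
Qed.

End gaussian_tensorization.

(** * Laplace transform of Lipschitz convex functions *)
Definition cvx (R : realType) (V : normedModType R) (f : V -> R) :=
  forall (s : R) x y, 0 <= s <= 1 ->
    f ((1 - s) *: x + s *: y) <= (1 - s) * f x + s * f y.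

Section real_integrable.
Context d (T : measurableType d) (R : realType) (P : {measure set T -> \bar R}).
Implicit Types X Y : T -> R.

Lemma integrable_EFinD X Y : P.-integrable setT (EFin \o X) ->
  P.-integrable setT (EFin \o Y) -> P.-integrable setT (EFin \o (fun w => X w + Y w)).
Proof. by move=> iX iY; exact: (integrableD measurableT iX iY). Qed.

Lemma integrable_EFinZ c X : P.-integrable setT (EFin \o X) ->
  P.-integrable setT (EFin \o (fun w => c * X w)).
Proof. by move=> iX; exact: (integrableZl measurableT c iX). Qed.

End real_integrable.

Section lipschitz_convex_laplace.
Context (R : realType) (n : nat) d (T : measurableType d) (P : probability T R)
  (Z : {RV P >-> borel_rV R n}) (hZ : std_gaussian_vector Z).
Implicit Types (f g h : 'rV[R]_n -> R).

Lemma measurable_lip L f : lip L f -> measurable_fun setT (fun w => f (Z w)).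
Proof.
move=> fL; rewrite (_ : (fun w => _) = fun w => f (truncate n (Z w))).
  exact: measurable_lip_truncate fL.
by apply/funext => w; rewrite truncate_id.
Qed.

Lemma integrable_expR_lip L f : lip L f ->
  P.-integrable setT (EFin \o (fun w => expR (f (Z w)))).
Proof.
move=> fL; rewrite (_ : (fun w => _) = fun w => expR (f (truncate n (Z w)))).
  exact: (integrable_expR_lip_truncate hZ (leqnn n) fL).
by apply/funext => w; rewrite truncate_id.
Qed.

Lemma integrable_le_expR L f (X : T -> R) : lip L f -> measurable_fun setT X ->
  (forall w, `|X w| <= expR (f (Z w))) -> P.-integrable setT (EFin \o X).
Proof.
move=> fL mX Xf; apply: le_integrable (integrable_expR_lip fL) => //.
  exact/measurable_EFinP.
by move=> w _; rewrite /= lee_fin [leRHS]ger0_norm ?expR_ge0.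
Qed.

Lemma integrable_lip L f : lip L f -> P.-integrable setT (EFin \o (fun w => f (Z w))).
Proof.
move=> fL; apply: (integrable_le_expR (lip_normr fL)); first exact: measurable_lip fL.
by move=> w; exact: ler_expR_id.
Qed.

Lemma integrable_lip_sqr L f : lip L f ->
  P.-integrable setT (EFin \o (fun w => f (Z w) ^+ 2)).
Proof.
move=> fL; apply: (integrable_le_expR (lipZ 2 (lip_normr fL))).
  by apply: measurable_funX; exact: measurable_lip fL.
move=> w; rewrite normrX mulrC mulr_natr mulr2n expRD expr2.
by apply: ler_pM; rewrite ?normr_ge0//; exact: ler_expR_id.
Qed.

(** A second-order expansion in c whose remainder does not depend on c, apart
    from the factor c ^ 3. *)
Lemma expR_scaled_le (c x : R) : 0 <= c <= 1 ->
  expR (c * x) <= 1 + c * x + c ^+ 2 * x ^+ 2 + c ^+ 3 * expR (4 * `|x|).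
Proof.
move=> /andP[c0 c1]; apply: le_trans (expR_le_quadratic _) _.
rewrite -[leRHS]addrA lerD2l exprMn normrM (ger0_norm c0).
have x0 : 0 <= `|x| by [].
have e1 : expR (c * `|x|) <= 1 + c * `|x| * expR `|x|.
  rewrite -lerBlDl; apply: le_trans (expR_sub1_le _) _.
  by apply: ler_wpM2l; rewrite ?mulr_ge0// ler_expR ler_piMl.
apply: le_trans (_ : c ^+ 2 * x ^+ 2 * (1 + c * `|x| * expR `|x|) <= _).
  by apply: ler_wpM2l => //; rewrite mulr_ge0 ?sqr_ge0.
rewrite mulrDr mulr1 lerD2l.
rewrite [leLHS](_ : _ = c ^+ 3 * (x ^+ 2 * `|x| * expR `|x|)); last by ring.
apply: ler_wpM2l; first exact: exprn_ge0.
rewrite -[x ^+ 2]real_normK ?num_real//.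
have -> : 4 * `|x| = (`|x| + `|x| + `|x|) + `|x| by ring.
rewrite !expRD expr2; apply: ler_wpM2r; first exact: expR_ge0.
have h := ler_expR_id `|x|.
by apply: ler_pM => //; exact: ler_pM.
Qed.

Lemma laplace_scaling L f (lam s : R) : 0 <= L -> lip L f -> cvx f ->
  0 <= lam <= 1 -> 0 <= s ->
  lam ^+ 2 * (ln (\int[P]_w expR (- s * f (Z w))) + s * \int[P]_w f (Z w)) <=
  ln (\int[P]_w expR (- (lam * s) * f (Z w))) + lam * s * \int[P]_w f (Z w).
Proof.
move=> L0 fL cf /andP[l0 l1] s0.
pose K := s * L.
have K0 : 0 <= K by rewrite mulr_ge0.
have lK (c : R) : `|c| <= s -> lip K (fun x => c * f x).
  by move=> cs; apply: lip_le (lipZ c fL); exact: ler_wpM2r.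
have ls : lam * s <= s by exact: ler_piMl.
have ls0 : 0 <= lam * s by exact: mulr_ge0.
have a1 : `|- (lam * s)| <= s by rewrite normrN ger0_norm.
have a2 : `|- (lam * s * (1 - lam))| <= s.
  rewrite normrN ger0_norm ?mulr_ge0 ?subr_ge0//.
  by apply: le_trans ls; apply: ler_piMr => //; rewrite lerBlDr lerDl.
have a3 : `|- s| <= s by rewrite normrN ger0_norm.
have H : interp lam 0 (fun x => - (lam * s) * f x)
    (fun x => - (lam * s * (1 - lam)) * f x) (fun x => - s * f x).
  move=> x y; rewrite subr0.
  rewrite [leLHS](_ : _ = - (lam * s) * ((1 - lam) * f x + lam * f y)); last by ring.
  by rewrite !mulNr lerN2; apply: ler_wpM2l => //; apply: cf; rewrite l0.
have := interp_gaussian_vector hZ l0 K0 (lK _ a1) (lK _ a2) (lK _ a3) H.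
rewrite RintegralZl//; last exact: integrable_lip fL.
move: (ln _) (ln _) (\int[P]_w f (Z w)) => A B m.
by rewrite mulrDr; move: (lam ^+ 2) (expr2 lam) => l2 -> ; nra.
Qed.

(** Expanding the right-hand side of [laplace_scaling] at lam = c gives
    Lambda(s) <= s ^ 2 Var + c K, with K independent of c. *)
Lemma lip_convex_laplace L f (s : R) : 0 <= L -> lip L f -> cvx f -> 0 <= s ->
  \int[P]_w expR (- s * f (Z w)) <=
  expR (- s * \int[P]_w f (Z w) +
        s ^+ 2 * \int[P]_w (f (Z w) - \int[P]_w f (Z w)) ^+ 2).
Proof.
move=> L0 fL cf s0.
set m := \int[P]_w f (Z w); set v := \int[P]_w _ ^+ 2.
have posE c : 0 < \int[P]_w expR (c * f (Z w)).
  apply: lt_le_trans (expR_gt0 (\int[P]_w (c * f (Z w)))) _.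
  apply: expR_Rintegral_le; first exact: integrable_lip (lipZ c fL).
  exact: integrable_expR_lip (lipZ c fL).
pose g x := - s * (f x - m).
have gL : lip (`|- s| * L) g.
  by apply: lipZ => x y; rewrite opprB addrA subrK.
pose K := \int[P]_w expR (4 * `|g (Z w)|).
have K0 : 0 <= K by apply: Rintegral_ge0 => w _; exact: expR_ge0.
have iK : P.-integrable setT (EFin \o (fun w => expR (4 * `|g (Z w)|))).
  exact: (integrable_expR_lip (lipZ 4 (lip_normr gL))).
have ig := integrable_lip gL.
have ig2 := integrable_lip_sqr gL.
have i1 : P.-integrable setT (EFin \o cst (1 : R)) by exact: finite_measure_integrable_cst.
have g0 : \int[P]_w g (Z w) = 0.
  rewrite /g RintegralZl//; last first.
    by apply: (integrable_lip (f := fun x => f x - m) (L := L)) => x y; rewrite opprB addrA subrK.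
  rewrite RintegralB//; last 2 first.
  - exact: integrable_lip fL.
  - exact: finite_measure_integrable_cst.
  by rewrite Rintegral_cst1 subrr mulr0.
have gv : \int[P]_w g (Z w) ^+ 2 = s ^+ 2 * v.
  rewrite /v -RintegralZl//; last first.
    by apply: (integrable_lip_sqr (f := fun x => f x - m) (L := L)) => x y; rewrite opprB addrA subrK.
  by apply: eq_Rintegral => w _; rewrite /g exprMn sqrrN.
have key c : 0 < c <= 1 ->
    ln (\int[P]_w expR (- s * f (Z w))) + s * m <= s ^+ 2 * v + c * K.
  move=> /andP[c0 c1].
  have c20 : 0 < c ^+ 2 by exact: exprn_gt0.
  rewrite -(ler_pM2l c20).
  have c01 : 0 <= c <= 1 by rewrite ltW.
  apply: le_trans (laplace_scaling L0 fL cf c01 s0) _; rewrite -/m.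
  have gE : \int[P]_w expR (c * g (Z w)) =
      expR (c * s * m) * \int[P]_w expR (- (c * s) * f (Z w)).
    rewrite -RintegralZl//; last exact: integrable_expR_lip (lipZ _ fL).
    by apply: eq_Rintegral => w _; rewrite -expRD; congr expR; rewrite /g; ring.
  have -> : ln (\int[P]_w expR (- (c * s) * f (Z w))) + c * s * m =
      ln (\int[P]_w expR (c * g (Z w))).
    by rewrite gE lnM ?posrE ?expR_gt0// expRK addrC.
  apply: le_trans (ln_le_subr1 _) _; first by rewrite gE mulr_gt0 ?expR_gt0.
  rewrite lerBlDr.
  have ib1 := integrable_EFinZ c ig.
  have ib2 := integrable_EFinD i1 ib1.
  have ib3 := integrable_EFinZ (c ^+ 2) ig2.
  have ib4 := integrable_EFinD ib2 ib3.
  have ib5 := integrable_EFinZ (c ^+ 3) iK.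
  have ib6 := integrable_EFinD ib4 ib5.
  apply: (@le_trans _ _ (\int[P]_w (1 + c * g (Z w) + c ^+ 2 * g (Z w) ^+ 2 +
      c ^+ 3 * expR (4 * `|g (Z w)|)))).
    apply: le_Rintegral => //; first exact: integrable_expR_lip (lipZ c gL).
    by move=> w _; exact: expR_scaled_le.
  rewrite (RintegralD measurableT ib4 ib5) (RintegralD measurableT ib2 ib3).
  rewrite (RintegralD measurableT i1 ib1).
  rewrite (@RintegralZl _ _ _ P setT _ c measurableT ig).
  rewrite (@RintegralZl _ _ _ P setT _ (c ^+ 2) measurableT ig2).
  rewrite (@RintegralZl _ _ _ P setT _ (c ^+ 3) measurableT iK).
  rewrite [X in X + _ + _ + _](Rintegral_cst1 P 1) g0 gv mulr0 addr0 -/K.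
  by rewrite le_eqVlt; apply/orP; left; apply/eqP; ring.
rewrite -[leLHS]lnK ?posrE// ler_expR.
suff : ln (\int[P]_w expR (- s * f (Z w))) + s * m <= s ^+ 2 * v.
  by move: (ln _) => A; lra.
apply/ler_addgt0Pr => eps eps0.
pose c := Num.min 1 (eps / (K + 1)).
have K1 : 0 < K + 1 by rewrite ltr_wpDl.
have c0 : 0 < c by rewrite lt_min ltr01 divr_gt0.
have c1 : c <= 1 by rewrite ge_min lexx.
apply: le_trans (key c _) _; first by rewrite c0.
rewrite lerD2l; apply: (@le_trans _ _ (eps / (K + 1) * (K + 1))); last by rewrite divfK ?gt_eqF.
apply: ler_pM => //; [exact: ltW|by rewrite ge_min lexx orbT|by rewrite lerDl].
Qed.

End lipschitz_convex_laplace.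

(** * Lipschitz envelopes of convex functions *)
Section convex_regularization.
Context {R : realType} {n : nat}.
Implicit Types (f : 'rV[R]_n -> R) (x y u : 'rV[R]_n).

(** Coordinate by coordinate: x + u is the midpoint of points in which the last
    coordinate and the preceding ones have been separated, at the cost of
    doubling the radius, and on a segment f is bounded by its end values. *)
Lemma cvx_locally_bounded f x (r : R) : cvx f -> 0 <= r ->
  exists C : R, forall u, `|u| <= r -> f (x + u) <= C.
Proof.
move=> cf r0.
suff H k : (k <= n)%N -> forall r, 0 <= r -> exists C : R, forall u, `|u| <= r ->
    f (x + truncate k u) <= C.
  have [C HC] := H n (leqnn n) r r0; exists C => u ur.
  by have := HC u ur; rewrite truncate_id.
elim: k => [_ r' _|k IH kn {r0}r r0].
  by exists (f x) => u _; rewrite truncate0 addr0.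
pose k' := Ordinal kn.
have [e eE] : exists e : 'rV[R]_n, e = delta_mx ord0 k' by exists (delta_mx ord0 k').
have [C HC] := IH (ltnW kn) (2 * r) (mulr_ge0 (ler0n _ 2) r0).
pose M := Num.max (f (x - (2 * r) *: e)) (f (x + (2 * r) *: e)).
have HM (t : R) : `|t| <= 2 * r -> f (x + t *: e) <= M.
  have [r1|rn0] := eqVneq r 0.
    rewrite /M r1 mulr0 normr_le0 => /eqP ->.
    by rewrite scale0r subr0 addr0 le_max lexx.
  have {}r0 : 0 < r by rewrite lt_neqAle eq_sym rn0.
  rewrite ler_norml => /andP[t1 t2].
  pose s := (t + 2 * r) / (4 * r).
  have s01 : 0 <= s <= 1.
    by rewrite divr_ge0 ?mulr_ge0 ?(ltW r0)//=; [rewrite ler_pdivrMr ?mulr_gt0//; lra|lra].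
  have -> : x + t *: e = (1 - s) *: (x - (2 * r) *: e) + s *: (x + (2 * r) *: e).
    by apply/rowP => j; rewrite !mxE /s; field; rewrite gt_eqF.
  apply: le_trans (cf _ _ _ s01) _; case/andP: s01 => s0 s1.
  rewrite [leRHS](_ : _ = (1 - s) * M + s * M); last by ring.
  apply: lerD; apply: ler_wpM2l; rewrite ?subr_ge0 ?le_max ?lexx ?orbT//.
exists (2^-1 * C + 2^-1 * M) => u ur.
have -> : x + truncate k.+1 u =
    (1 - 2^-1) *: (x + truncate k (2 *: u)) + 2^-1 *: (x + (2 * u ord0 k') *: e).
  rewrite (truncateS k' u) -eE (_ : truncate k (2 *: u) = 2 *: truncate k u); last first.
    by apply/rowP => j; rewrite !mxE; case: ifP; rewrite ?mulr0.
  by move: (truncate k u) (u ord0 k') => p c; apply/rowP => j; rewrite !mxE; field.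
have h2 : 0 <= (2^-1 : R) <= 1 by apply/andP; split; lra.
apply: le_trans (cf _ _ _ h2) _.
have -> : 1 - 2^-1 = 2^-1 :> R by field.
apply: lerD; apply: ler_wpM2l; rewrite ?invr_ge0//.
  by apply: HC; rewrite normrZ ger0_norm// ler_pM2l.
apply: HM; rewrite normrM ger0_norm// ler_pM2l//.
exact: le_trans (rV_coord_le _ _) ur.
Qed.

(** A substitute for a subgradient. The point z at distance 1 from x on the side
    opposite to y has f z <= C, and x is a convex combination of y and z, which
    bounds f y from below. *)
Lemma cvx_cone_minorant f x : cvx f ->
  exists2 K : R, 0 <= K & forall y, f x - K * `|y - x| <= f y.
Proof.
move=> cf; have [C HC] := cvx_locally_bounded x cf ler01.
have fC : f x <= C by have := HC 0; rewrite normr0 addr0; apply.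
exists (C - f x); first by rewrite subr_ge0.
move=> y; have [->|yx] := eqVneq y x; first by rewrite subrr normr0 mulr0 subr0.
pose dl := `|y - x|.
have d0 : 0 < dl by rewrite normr_gt0 subr_eq0.
pose s := dl / (1 + dl).
have d1 : 0 < 1 + dl by rewrite addr_gt0.
have s01 : 0 <= s <= 1.
  by rewrite divr_ge0 ?(ltW d0) ?(ltW d1)//= ler_pdivrMr// mul1r lerDr.
pose z := x - dl^-1 *: (y - x).
have fz : f z <= C.
  apply: HC; rewrite normrN normrZ ger0_norm ?invr_ge0 ?(ltW d0)//.
  by rewrite mulVf// gt_eqF.
have xE : x = (1 - s) *: y + s *: z.
  have sd : s * dl^-1 = 1 - s by rewrite /s; field; rewrite !gt_eqF.
  rewrite /z scalerBr scalerA sd; move: (s) => s'.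
  by apply/rowP => j; rewrite !mxE; ring.
have := cf s y z s01; rewrite -xE.
have s1 : 1 - s = (1 + dl)^-1 by rewrite /s; field; rewrite gt_eqF.
rewrite s1 /s -mulrA mulrCA -mulrDr mulrC -ler_pdivrMr ?invr_gt0// invrK.
rewrite -/dl => h.
have : dl * f z <= dl * C by rewrite ler_pM2l.
move: (f z) h => fz' h; rewrite mulrDr mulr1 in h.
by move: (f x) (f y) fC h => A B fC h; lra.
Qed.

Definition lip_envelope (N : R) f x : R := inf [set f y + N * `|x - y| | y in setT].

Section envelope.
Context (f : 'rV[R]_n -> R) (K0 N : R) (cf : cvx f) (K00 : 0 <= K0)
  (fK0 : forall y, f 0 - K0 * `|y| <= f y) (K0N : K0 <= N).

Let S x := [set f y + N * `|x - y| | y in setT].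

Lemma envelope_lb x y : f 0 - K0 * `|x| <= f y + N * `|x - y|.
Proof.
have h1 := fK0 y.
have h2 : K0 * `|x - y| <= N * `|x - y| by exact: ler_wpM2r.
have h3 : K0 * `|y| <= K0 * `|x| + K0 * `|x - y|.
  rewrite -mulrDr; apply: ler_wpM2l => //.
  by rewrite -{1}(subrK x y) addrC -[y - x]opprB; apply: le_trans (ler_normB _ _) _.
by move: (f 0) (f y) h1 => A B h1; lra.
Qed.

Lemma envelope_has_inf x : has_inf (S x).
Proof.
split; first by exists (f x + N * `|x - x|); exists x.
by exists (f 0 - K0 * `|x|) => _ [y _ <-]; exact: envelope_lb.
Qed.

Lemma envelope_le x y : lip_envelope N f x <= f y + N * `|x - y|.
Proof. by apply: ge_inf; [exact: (envelope_has_inf x).2|exists y]. Qed.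

Lemma envelope_ge x c : (forall y, c <= f y + N * `|x - y|) -> c <= lip_envelope N f x.
Proof.
move=> H; apply: lb_le_inf; first exact: (envelope_has_inf x).1.
by move=> _ [y _ <-].
Qed.

Lemma envelope_lip : lip N (lip_envelope N f).
Proof.
have N0 : 0 <= N by exact: le_trans K0N.
have H x y : lip_envelope N f x - N * `|x - y| <= lip_envelope N f y.
  apply: envelope_ge => z; rewrite lerBlDr; apply: le_trans (envelope_le x z) _.
  rewrite -addrA lerD2l -mulrDr; apply: ler_wpM2l => //.
  by rewrite [leRHS]addrC; exact: ler_distD.
move=> x y; rewrite ler_norml; apply/andP; split.
  by rewrite lerBrDr addrC -[`|x - y|]distrC; exact: H.
by rewrite lerBlDr -lerBlDl; exact: H.
Qed.

Lemma envelope_cvx : cvx (lip_envelope N f).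
Proof.
have N0 : 0 <= N by exact: le_trans K0N.
move=> s x y /andP[s0 s1]; apply/ler_addgt0Pr => eps eps0.
have [_ [x' _ <-] hx] := inf_adherent eps0 (envelope_has_inf x).
have [_ [y' _ <-] hy] := inf_adherent eps0 (envelope_has_inf y).
apply: le_trans (envelope_le _ ((1 - s) *: x' + s *: y')) _.
have s1' : 0 <= 1 - s by rewrite subr_ge0.
have h1 : f ((1 - s) *: x' + s *: y') <= (1 - s) * f x' + s * f y' by apply: cf; rewrite s0.
have h2 : `|(1 - s) *: x + s *: y - ((1 - s) *: x' + s *: y')| <=
    (1 - s) * `|x - x'| + s * `|y - y'|.
  rewrite opprD addrACA -!scalerBr; apply: le_trans (ler_normD _ _) _.
  by rewrite !normrZ !ger0_norm.
have {}h2 := ler_wpM2l N0 h2.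
have {}hx := ler_wpM2l s1' (ltW hx).
have {}hy := ler_wpM2l s0 (ltW hy).
move: h1 h2 hx hy; rewrite -/(lip_envelope N f x) -/(lip_envelope N f y).
move: (f _) (f x') (f y') (`|_|) `|x - x'| `|y - y'| (lip_envelope N f x) (lip_envelope N f y).
by move=> A B C D E F G H; nra.
Qed.

Lemma envelope_le_self x : lip_envelope N f x <= f x.
Proof. by apply: le_trans (envelope_le x x) _; rewrite subrr normr0 mulr0 addr0. Qed.

Lemma envelope_eq (K : R) x : (forall y, f x - K * `|y - x| <= f y) -> K <= N ->
  lip_envelope N f x = f x.
Proof.
move=> HK KN; apply/eqP; rewrite eq_le envelope_le_self/=.
apply: envelope_ge => y; rewrite -lerBlDr; apply: le_trans (HK y).
by rewrite lerD2l lerN2 distrC; exact: ler_wpM2r.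
Qed.

End envelope.

End convex_regularization.

(** * Laplace transform of square-integrable convex functions *)
Section square_integrable.
Context d (T : measurableType d) (R : realType) (P : probability T R).
Implicit Types X Y : T -> R.

Lemma integrable_sqr_integrable X : measurable_fun setT X ->
  P.-integrable setT (EFin \o (fun w => X w ^+ 2)) -> P.-integrable setT (EFin \o X).
Proof.
move=> mX iX2.
have i1 : P.-integrable setT (EFin \o cst (1 : R)) by exact: finite_measure_integrable_cst.
apply: le_integrable (integrable_EFinD i1 iX2) => //; first exact/measurable_EFinP.
move=> w _; rewrite /= lee_fin [leRHS]ger0_norm ?addr_ge0 ?sqr_ge0//.
rewrite -[X w ^+ 2]real_normK ?num_real//.
by have := sqr_ge0 (`|X w| - 2^-1); move: (`|X w|) => a; nra.
Qed.

Lemma Rintegral_variance X : P.-integrable setT (EFin \o X) ->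
  P.-integrable setT (EFin \o (fun w => X w ^+ 2)) ->
  \int[P]_w (X w - \int[P]_w X w) ^+ 2 = \int[P]_w X w ^+ 2 - (\int[P]_w X w) ^+ 2.
Proof.
move=> iX iX2; set m := \int[P]_w X w.
have i1 : P.-integrable setT (EFin \o cst (m ^+ 2 : R)) by exact: finite_measure_integrable_cst.
have iZ := integrable_EFinZ (- (2 * m)) iX.
transitivity (\int[P]_w (X w ^+ 2 + (- (2 * m) * X w + m ^+ 2))).
  by apply: eq_Rintegral => w _; ring.
rewrite (RintegralD measurableT iX2 (integrable_EFinD iZ i1)) (RintegralD measurableT iZ i1).
rewrite (@RintegralZl _ _ _ P setT _ _ measurableT iX) -/m.
by rewrite [X in _ + (_ + X)](Rintegral_cst1 P (m ^+ 2)); ring.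
Qed.

Lemma Rintegral_dominated_cvg (X_ : nat -> T -> R) X Y :
  (forall k, measurable_fun setT (X_ k)) -> measurable_fun setT X ->
  P.-integrable setT (EFin \o Y) ->
  (forall w, exists k0 : nat, forall k, (k0 <= k)%N -> X_ k w = X w) ->
  (forall k w, `|X_ k w| <= Y w) ->
  (\int[P]_w X_ k w) @[k --> \oo] --> \int[P]_w X w.
Proof.
move=> mX_ mX iY XX XY.
have mE k : measurable_fun setT (EFin \o X_ k) by apply/measurable_EFinP.
have mEX : measurable_fun setT (EFin \o X) by apply/measurable_EFinP.
have ae1 : {ae P, forall w, [set: T] w -> (EFin \o X_ k) w @[k --> \oo] --> (EFin \o X) w}.
  apply: aeW => w _; have [k0 Hk] := XX w.
  by apply: cvg_near_cst; exists k0 => // k /= kk; rewrite Hk.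
have ae2 : {ae P, forall w k, [set: T] w -> (`|(EFin \o X_ k) w| <= (EFin \o Y) w)%E}.
  by apply: aeW => w k _; rewrite /= lee_fin; exact: XY.
have [iX _ cX] := dominated_convergence measurableT mE mEX ae1 iY ae2.
have fX : (\int[P]_w (X w)%:E)%E \is a fin_num by exact: integrable_fin_num.
by move: cX; rewrite -(fineK fX) => /fine_cvgP[].
Qed.

End square_integrable.

Section convex_laplace.
Context (R : realType) (n : nat) d (T : measurableType d) (P : probability T R)
  (Z : {RV P >-> borel_rV R n}) (hZ : std_gaussian_vector Z).

(** The envelopes of f lie between the first one and f, so their means and
    variances converge by domination, while exp (- s f) is at most the
    exponential for each envelope. *)
Theorem convex_laplace (f : 'rV[R]_n -> R) (s : R) : cvx f ->
  measurable_fun setT (fun w => f (Z w)) ->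
  P.-integrable setT (EFin \o (fun w => f (Z w) ^+ 2)) -> 0 <= s ->
  (\int[P]_w (expR (- s * f (Z w)))%:E <=
    (expR (- s * \int[P]_w f (Z w) +
          s ^+ 2 * \int[P]_w (f (Z w) - \int[P]_w f (Z w)) ^+ 2))%:E)%E.
Proof.
move=> cf mf if2 s0.
have [K0 K00 HK0] := cvx_cone_minorant 0 cf.
have {}HK0 y : f 0 - K0 * `|y| <= f y by have := HK0 y; rewrite subr0.
pose g (k : nat) := lip_envelope (K0 + k%:R) f.
have KN k : K0 <= K0 + k%:R by rewrite lerDl.
have N0 k : 0 <= K0 + k%:R by exact: le_trans (KN k).
have gL k : lip (K0 + k%:R) (g k) by exact: envelope_lip (KN k).
have gC k : cvx (g k) by exact: envelope_cvx (KN k).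
have gf k x : g k x <= f x by exact: envelope_le_self (KN k) x.
have gE x : exists k0 : nat, forall k, (k0 <= k)%N -> g k x = f x.
  have [K _ HK] := cvx_cone_minorant x cf.
  exists (Num.truncn K).+1 => k kk; apply: (envelope_eq K00 HK0 (KN k) HK).
  apply: (@le_trans _ _ k%:R); last by rewrite lerDr.
  by apply: le_trans (ltW (truncnS_gt K)) _; rewrite ler_nat.
have g0 k x : g 0%N x <= g k x.
  apply: envelope_ge (KN k) _ _ _ => // y.
  apply: le_trans (envelope_le K00 HK0 (KN 0%N) x y) _.
  by rewrite lerD2l; apply: ler_wpM2r => //; rewrite lerD2l ler_nat.
have ab k x : `|g k x| <= `|f x| + `|g 0%N x|.
  have := gf k x; have := g0 k x; rewrite ler_norml => h1 h2.
  have := ler_norm (f x); have := ler_norm (- g 0%N x); rewrite normrN => h3 h4.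
  have h5 : 0 <= `|f x| by [].
  have h6 : 0 <= `|g 0%N x| by [].
  move: (g k x) (g 0%N x) (f x) (`|f x|) (`|g 0%N x|) h1 h2 h3 h4 h5 h6 => A B C D E *.
  by apply/andP; split; lra.
have if1 := integrable_sqr_integrable mf if2.
have mg k : measurable_fun setT (fun w => g k (Z w)) by exact: measurable_lip (gL k).
have ig k := integrable_lip hZ (gL k).
have ig2 k := integrable_lip_sqr hZ (gL k).
have ifn : P.-integrable setT (EFin \o (fun w => `|f (Z w)|)).
  by apply: le_integrable if1 => //; [apply/measurable_EFinP; exact: measurableT_comp|
    move=> w _; rewrite /= normr_id].
have ign : P.-integrable setT (EFin \o (fun w => `|g 0%N (Z w)|)).
  by apply: le_integrable (ig 0%N) => //; [apply/measurable_EFinP; exact: measurableT_comp|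
    move=> w _; rewrite /= normr_id].
have c1 : (\int[P]_w g k (Z w)) @[k --> \oo] --> \int[P]_w f (Z w).
  apply: (Rintegral_dominated_cvg mg mf (integrable_EFinD ifn ign)).
  - by move=> w; exact: gE.
  - by move=> k w; exact: ab.
have c2 : (\int[P]_w g k (Z w) ^+ 2) @[k --> \oo] --> \int[P]_w f (Z w) ^+ 2.
  have iY := integrable_EFinD (integrable_EFinZ 2 if2) (integrable_EFinZ 2 (ig2 0%N)).
  apply: (Rintegral_dominated_cvg _ _ iY).
  - by move=> k; exact: measurable_funX.
  - exact: measurable_funX.
  - by move=> w; have [k0 Hk] := gE (Z w); exists k0 => k kk; rewrite Hk.
  - move=> k w; rewrite normrX; have := ab k (Z w).
    rewrite -[f (Z w) ^+ 2]real_normK ?num_real// -[g 0%N (Z w) ^+ 2]real_normK ?num_real//.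
    have : 0 <= `|g k (Z w)| by [].
    move: (`|g k (Z w)|) (`|f (Z w)|) (`|g 0%N (Z w)|) => A B C.
    by have := sqr_ge0 (B - C); nra.
pose m := \int[P]_w f (Z w).
pose bound k := expR (- s * \int[P]_w g k (Z w) +
   s ^+ 2 * (\int[P]_w g k (Z w) ^+ 2 - (\int[P]_w g k (Z w)) ^+ 2)).
have cb : bound k @[k --> \oo] -->
    expR (- s * m + s ^+ 2 * (\int[P]_w f (Z w) ^+ 2 - m ^+ 2)).
  apply: (@cvg_comp _ _ _ (fun k => _) expR); last exact: continuous_expR.
  apply: cvgD; first by apply: cvgMr; exact: c1.
  apply: cvgMr; apply: cvgB; first exact: c2.
  by apply: (@cvg_comp _ _ _ (fun k => _) (fun x => x ^+ 2)); [exact: c1|exact: sqr_continuous].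
rewrite (Rintegral_variance if1 if2) -/m.
have mE : measurable_fun setT (fun w => expR (- s * f (Z w))).
  by apply: measurableT_comp => //; exact: measurable_funM.
have le k : (\int[P]_w (expR (- s * f (Z w)))%:E <= (bound k)%:E)%E.
  have iE := integrable_expR_lip hZ (lipZ (- s) (gL k)).
  apply: (@le_trans _ _ (\int[P]_w (expR (- s * g k (Z w)))%:E)%E).
    apply: ge0_le_integral => //.
    - exact/measurable_EFinP.
    - by have := measurable_int _ iE.
    - by move=> w _; rewrite lee_fin ler_expR !mulNr lerN2; apply: ler_wpM2l.
  rewrite -[leLHS]fineK; last exact: integrable_fin_num.
  rewrite lee_fin; apply: le_trans (lip_convex_laplace hZ (N0 k) (gL k) (gC k) s0) _.
  by rewrite (Rintegral_variance (ig k) (ig2 k)).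
have fI : (\int[P]_w (expR (- s * f (Z w)))%:E)%E \is a fin_num.
  rewrite ge0_fin_numE; first exact: le_lt_trans (le 0%N) (ltry _).
  by apply: integral_ge0 => w _; rewrite lee_fin expR_ge0.
move: le; rewrite -(fineK fI) => le.
rewrite lee_fin -(cvg_lim (@Rhausdorff R) cb); apply: limr_ge.
  by apply/cvg_ex; eexists; exact: cb.
by near=> k; rewrite -lee_fin; exact: le.
Unshelve. all: by end_near. Qed.

End convex_laplace.

(** * Numerical comparison of the tails *)
Section numeric_bounds.
Context {R : realType}.
Implicit Types t : R.

Lemma pi_le4 : pi <= 4 :> R.
Proof.
have := @pihalf_lt2 R.
lra.
Qed.

(** The exponents differ by at most 1/4, and exp (1/4) < 2. *)
Lemma tail_bound_lt t : 1 < t ->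
  2^-1 * expR (- (pi / 1024) * (t - 1) ^+ 2) < expR (- (t ^+ 2 / 1000)).
Proof.
move=> t1; have p2 := @pi_ge2 R.
have sq : 0 <= (t - 1) ^+ 2 by exact: sqr_ge0.
have h : t ^+ 2 / 1000 - (pi / 1024) * (t - 1) ^+ 2 <= 4^-1.
  have : 0 <= (pi - 2) * (t - 1) ^+ 2 by rewrite mulr_ge0// subr_ge0.
  by have := sqr_ge0 (t - 3); nra.
have e1 := expR_ge1Dx (- (4^-1 : R)).
have e2 : expR (4^-1 : R) * expR (- 4^-1) = 1 by rewrite -expRD subrr expR0.
have e3 : expR (4^-1 : R) < 2 by have := expR_gt0 (4^-1 : R); nra.
have e4 : expR (t ^+ 2 / 1000 - (pi / 1024) * (t - 1) ^+ 2) < 2.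
  by apply: le_lt_trans e3; rewrite ler_expR.
have e5 : expR (- (pi / 1024) * (t - 1) ^+ 2) =
    expR (- (t ^+ 2 / 1000)) * expR (t ^+ 2 / 1000 - (pi / 1024) * (t - 1) ^+ 2).
  by rewrite -expRD; congr expR; ring.
by rewrite e5; have := expR_gt0 (- (t ^+ 2 / 1000)); nra.
Qed.

Lemma cantelli_le_tail_bound t : 1 < t -> t <= 2 ->
  (1 + t ^+ 2)^-1 <= 2^-1 * expR (- (pi / 1024) * (t - 1) ^+ 2).
Proof.
move=> t1 t2; have p4 := pi_le4; have p0 := @pi_gt0 R.
have h := expR_ge1Dx (- (pi / 1024) * (t - 1) ^+ 2).
apply: (@le_trans _ _ (2^-1 * (1 - (t - 1) ^+ 2 / 256))).
  have s0 : 0 < 1 + t ^+ 2 by rewrite ltr_pwDl// sqr_ge0.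
  rewrite -[leLHS]mul1r ler_pdivrMr//.
  have : 0 <= (t - 1) * (2 - t) by rewrite mulr_ge0// subr_ge0// ltW.
  move=> h1.
  have h2 : (1 + t ^+ 2) <= 5 by nra.
  have h3 : (t - 1) ^+ 2 <= t - 1 by nra.
  have h4 : (t - 1) ^+ 2 * (1 + t ^+ 2) <= 5 * (t - 1).
    apply: le_trans (_ : (t - 1) * (1 + t ^+ 2) <= _).
      by apply: ler_wpM2r => //; exact: ltW.
    by rewrite mulrC; apply: ler_wpM2r => //; rewrite subr_ge0 ltW.
  by nra.
rewrite ler_pM2l ?invr_gt0//; apply: le_trans h.
have : 0 <= (4 - pi) * (t - 1) ^+ 2 by rewrite mulr_ge0 ?sqr_ge0 ?subr_ge0.
by move: ((t - 1) ^+ 2) => u; nra.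
Qed.

(** The difference y of the exponents is at least 9/10, and
    2 < (1 + 9/20) ^ 2 <= exp y. *)
Lemma chernoff_le_tail_bound t : 2 <= t ->
  expR (- (t ^+ 2 / 4)) <= 2^-1 * expR (- (pi / 1024) * (t - 1) ^+ 2).
Proof.
move=> t2; have p4 := pi_le4; have p0 := @pi_gt0 R.
have y9 : 9 / 10 <= t ^+ 2 / 4 - (pi / 1024) * (t - 1) ^+ 2.
  have : 0 <= (4 - pi) * (t - 1) ^+ 2 by rewrite mulr_ge0 ?sqr_ge0 ?subr_ge0.
  by nra.
set y := t ^+ 2 / 4 - _ in y9.
have -> : - (pi / 1024) * (t - 1) ^+ 2 = y - t ^+ 2 / 4 by rewrite /y; ring.
rewrite expRD mulrA; apply: ler_peMl; first exact: expR_ge0.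
have : expR (y / 2) ^+ 2 = expR y by rewrite -expRM_natl; congr expR; field.
move=> <-.
have := expR_ge1Dx (y / 2).
move: (expR (y / 2)) => E hE.
have : 29 / 20 <= E by lra.
by nra.
Qed.

End numeric_bounds.

(** * Lower tails *)
Lemma convex_function_cvx (R : realType) n (f : 'rV[R]_n -> R) :
  convex_function [set: convex_lmodType 'rV[R]_n] f -> cvx f.
Proof.
move=> cf s x y /andP[s0 s1].
have : f (s *: y + (1 - s) *: x) <= s * f y + (1 - s) * f x.
  exact: cf (Itv01 s0 s1) y x (in_setT _) (in_setT _).
by rewrite addrC [leRHS]addrC.
Qed.

Section chernoff_cantelli.
Context d (T : measurableType d) (R : realType) (P : probability T R).

Lemma measurable_set_lt (X : T -> R) a : measurable_fun setT X ->
  measurable [set w | X w < a].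
Proof.
move=> mX; rewrite [X in measurable X](_ : _ = setT `&` X @^-1` `]-oo, a[%classic).
  by apply: mX => //; exact: measurable_itv.
by rewrite setTI; apply/seteqP; split => w /=; rewrite in_itv.
Qed.

Lemma measurable_set_ge (X : T -> R) a : measurable_fun setT X ->
  measurable [set w | a <= X w].
Proof.
move=> mX; rewrite [X in measurable X](_ : _ = setT `&` X @^-1` `[a, +oo[%classic).
  by apply: mX => //; exact: measurable_itv.
by rewrite setTI; apply/seteqP; split => w /=; rewrite in_itv/= andbT.
Qed.

Lemma lower_tail_zero_variance (X : {RV P >-> R}) :
  P.-integrable setT (EFin \o (fun w => X w ^+ 2)) ->
  \int[P]_w (X w - \int[P]_w X w) ^+ 2 = 0 ->
  P [set w | X w - \int[P]_w X w < 0] = 0%E.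
Proof.
move=> iX2; set m := \int[P]_w X w => v0.
have mX : measurable_fun setT X by [].
have mY : measurable_fun setT (fun w => X w - m) by exact: measurable_funB.
have mA : measurable [set w | X w - m < 0] by exact: measurable_set_lt.
have iX := integrable_sqr_integrable mX iX2.
have fin : (\int[P]_w ((X w - m) ^+ 2)%:E)%E \is a fin_num.
  have i1 : P.-integrable setT (EFin \o cst (m ^+ 2 : R)) by exact: finite_measure_integrable_cst.
  have := integrable_EFinD iX2 (integrable_EFinD (integrable_EFinZ (- (2 * m)) iX) i1).
  move=> /(integrable_fin_num measurableT); congr (_ \is a fin_num).
  by apply: eq_integral => w _ /=; congr EFin; ring.
have I0 : (\int[P]_w `|((X w - m) ^+ 2)%:E|)%E = 0%E.
  transitivity ((\int[P]_w ((X w - m) ^+ 2)%:E)%E).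
    by apply: eq_integral => w _; rewrite /= ger0_norm ?sqr_ge0.
  by rewrite -(fineK fin); congr EFin; exact: v0.
have mY2 : measurable_fun setT (fun w => ((X w - m) ^+ 2)%:E).
  by apply/measurable_EFinP; exact: measurable_funX.
have /(ae_eq_integral_abs _ measurableT mY2)[N [mN N0 AN]] := I0.
apply/eqP; rewrite -measure_le0 -N0; apply: le_measure; rewrite ?inE// => w /= Xw.
apply: AN => /= /(_ I) [] /eqP; rewrite sqrf_eq0 => /eqP h.
by rewrite h ltxx in Xw.
Qed.

Lemma lower_tail_cantelli (X : {RV P >-> R}) (t : R) : 0 < t ->
  (X : T -> R) \in Lfun P 2%:E -> 0 < fine 'V_P[X] ->
  (P [set w | (X w - fine 'E_P[X] < - t * Num.sqrt (fine 'V_P[X]))%R] <=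
    ((1 + t ^+ 2)^-1)%:E)%E.
Proof.
move=> t0 X2; set v := fine _ => v0.
have X1 : (X : T -> R) \in Lfun P 1.
  exact: (Lfun_subset12 (fin_num_measure P _ measurableT)).
pose Y : {RV P >-> R} := (- X)%R.
have Y2 : (Y : T -> R) \in Lfun P 2%:E by rewrite rpredN.
have lam0 : 0 < t * Num.sqrt v by rewrite mulr_gt0// sqrtr_gt0.
have EY : ('E_P[Y] = (- fine 'E_P[X])%:E)%E.
  rewrite (_ : (Y : T -> R) = (-1) \o* X); last by apply/funext => w; rewrite /= mulrN1.
  by rewrite expectationZl// -[in LHS](fineK (expectation_fin_num X1)) -EFinM mulN1r.
have VY : ('V_P[Y] = 'V_P[X])%E by exact: (varianceN X2).
have := cantelli Y2 lam0; rewrite VY -/v EY.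
have -> : v / (v + (t * Num.sqrt v) ^ 2) = (1 + t ^+ 2)^-1.
  rewrite -[X in _ + X]/((t * Num.sqrt v) ^+ 2) exprMn sqr_sqrtr ?ltW//.
  by rewrite -[X in X + _]mul1r -mulrDl invfM mulrCA mulfV ?mulr1// gt_eqF.
have mX c : measurable_fun setT (fun w => X w + c) by exact: measurable_funD.
have mYc c : measurable_fun setT (fun w => Y w + c) by exact: measurable_funD.
apply: le_trans.
rewrite [X in (_ <= P X)%E](_ : _ = [set w | t * Num.sqrt v <= Y w + fine 'E_P[X]]); last first.
  by apply/seteqP; split => w /=; rewrite -EFinB opprK lee_fin.
apply: le_measure; rewrite ?inE.
- exact: measurable_set_lt.
- exact: measurable_set_ge.
- move=> w /=; rewrite /Y /= mulNr ltrNr => /ltW h.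
  by apply: le_trans h _; rewrite opprB addrC.
Qed.

(** Chernoff's bound at the minimiser s = t / (2 sqrt v). *)
Lemma lower_tail_chernoff (X : {RV P >-> R}) (m v t : R) : 0 < t -> 0 < v ->
  (forall s, 0 <= s -> (\int[P]_w (expR (- s * X w))%:E <=
     (expR (- s * m + s ^+ 2 * v))%:E)%E) ->
  (P [set w | (X w - m < - t * Num.sqrt v)%R] <= (expR (- (t ^+ 2 / 4)))%:E)%E.
Proof.
move=> t0 v0 H.
have sv0 : 0 < Num.sqrt v by rewrite sqrtr_gt0.
pose s := t / (2 * Num.sqrt v).
have s0 : 0 < s by rewrite divr_gt0// mulr_gt0.
pose Y : {RV P >-> R} := (- X)%R.
have mX c : measurable_fun setT (fun w => X w + c) by exact: measurable_funD.
apply: (@le_trans _ _ (P [set w | (t * Num.sqrt v - m <= Y w)%R])).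
  apply: le_measure; rewrite ?inE.
  - exact: measurable_set_lt.
  - exact: measurable_set_ge.
  - move=> w /=; rewrite /Y /= mulNr ltrNr => /ltW h.
    by rewrite lerBlDr; apply: le_trans h _; rewrite opprB addrC.
apply: le_trans (chernoff Y (t * Num.sqrt v - m) s0) _.
apply: (@le_trans _ _ ((expR (- s * m + s ^+ 2 * v))%:E * (expR (- (s * (t * Num.sqrt v - m))))%:E)%E).
  apply: lee_wpmul2r; first by rewrite lee_fin expR_ge0.
  apply: le_trans (H s (ltW s0)); rewrite /mmt_gen_fun unlock.
  rewrite le_eqVlt; apply/orP; left; apply/eqP; apply: eq_integral => w _ /=.
  by congr (expR _)%:E; rewrite mulrC mulrN mulNr.
rewrite -EFinM -expRD lee_fin ler_expR le_eqVlt; apply/orP; left; apply/eqP.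
have -> : s ^+ 2 * v = t ^+ 2 / 4.
  by rewrite -[X in _ * X](sqr_sqrtr (ltW v0)) /s; field; rewrite gt_eqF.
have -> : s * (t * Num.sqrt v - m) = t ^+ 2 / 2 - s * m by rewrite /s; field; rewrite gt_eqF.
by field.
Qed.

End chernoff_cantelli.

Theorem mainTheorem2 (R : realType) (n : nat) (hn : (1 <= n)%N)
    (d : measure_display) (T : measurableType d) (P : probability T R)
    (Z : {RV P >-> borel_rV R n}) (hZ : std_gaussian_vector Z)
    (f : 'rV[R]_n -> R)
    (hconv : convex_function [set: convex_lmodType 'rV[R]_n] f)
    (hL2 : (f : borel_rV R n -> R) \in Lfun (distribution P Z) 2%:E)
    (t : R) (ht : 1 < t) :
  (P [set w | (f (Z w) - fine 'E_P[f \o Z] <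
              - t * Num.sqrt (fine 'V_P[f \o Z]))%R] <=
   (2^-1 * expR (- (pi / 1024) * (t - 1) ^+ 2))%:E)%E /\
  2^-1 * expR (- (pi / 1024) * (t - 1) ^+ 2) < expR (- (t ^+ 2 / 1000)).
Proof.
split; last exact: tail_bound_lt.
have t0 : 0 < t by exact: lt_trans ht.
have cf := convex_function_cvx hconv.
have mf : measurable_fun setT (f : borel_rV R n -> R).
  by move: hL2; rewrite inE => /andP[]; rewrite inE.
have mX : measurable_fun setT (fun w => f (Z w)).
  by apply: (@measurableT_comp _ _ _ _ _ _ (f : borel_rV R n -> R)).
pose X : {RV P >-> R} := mfun_Sub (mem_set mX).
have X2 : (X : T -> R) \in Lfun P 2%:E.
  move: hL2; rewrite !inE => /andP[_]; rewrite inE/= /finite_norm => fN.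
  apply/andP; split; rewrite inE//= /finite_norm.
  move: fN; rewrite unlock ge0_integral_distribution//.
    apply: (measurableT_comp (measurable_poweR _)) => //.
    by apply: measurableT_comp => //; exact/measurable_EFinP.
  by move=> y; exact: poweR_ge0.
have iX2 : P.-integrable setT (EFin \o (fun w => f (Z w) ^+ 2)) := Lfun2_integrable_sqr X2.
have iX := integrable_sqr_integrable mX iX2.
have EE : fine 'E_P[f \o Z] = \int[P]_w f (Z w) by rewrite unlock.
have VV : fine 'V_P[f \o Z] = \int[P]_w (f (Z w) - \int[P]_w f (Z w)) ^+ 2.
  by rewrite /variance unlock -EE unlock /Rintegral; congr fine.
have v0 : 0 <= fine 'V_P[f \o Z] by rewrite fine_ge0// variance_ge0.
have [vz|vn] := eqVneq (fine 'V_P[f \o Z]) 0.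
  rewrite vz sqrtr0 mulr0 EE.
  have := lower_tail_zero_variance (X := X) iX2; rewrite -VV => /(_ vz) => ->.
  by rewrite lee_fin mulr_ge0 ?expR_ge0.
have vp : 0 < fine 'V_P[f \o Z] by rewrite lt_neqAle eq_sym vn.
have [t2|t2] := lerP t 2.
  apply: le_trans (lower_tail_cantelli (X := X) t0 X2 vp) _.
  by rewrite lee_fin; exact: cantelli_le_tail_bound.
apply: (@le_trans _ _ (expR (- (t ^+ 2 / 4)))%:E); last first.
  by rewrite lee_fin; apply: chernoff_le_tail_bound; exact: ltW.
apply: (lower_tail_chernoff (X := X) t0 vp) => s s0.
by rewrite EE VV; exact: (convex_laplace hZ).
Qed.
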